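(* There exist universal absolute constants $C,C'>0$ such that for any $\delta\in(0,1/3]$, the estimator $\widehat\mu_\delta=\widehat\mu_\delta(X_{1:n})$ defined in the context satisfies $$\inf_{\mu\in\mathbb R}\ \mathbb P_{X_1,\dots,X_n\overset{\mathrm{iid}}{\sim}f_\mu}\left(|\widehat\mu_\delta-\mu|\le\omega_f\Big(\frac{C\log(1/\delta)}{n}\Big)\right)\ge1-\delta\qquad\text{whenever } n\ge C'\log(1/\delta),$$ for every $f\in\mathcal F_{\mathsf{SUMHR}}$.
   Context: $\mathcal F_{\mathsf{SUMHR}}$ is the class of probability densities $f$ on $\mathbb R$ with $f(x)=f(-x)$, $f$ non-increasing on $[0,+\infty)$, and hazard function $h_f(x)=f(x)/(1-F(x))$ non-decreasing on the interior of the support $\{f>0\}$, where $F$ is the cumulative distribution function of $f$. $f_\mu(x)=f(x-\mu)$; $\mathsf H^2(P,Q)=\frac12\int(\sqrt{dP}-\sqrt{dQ})^2$; $\omega_f(t)=\sup\{r\ge0:\mathsf H^2(f_0,f_{2r})\le t\}$ for $t\in[0,1]$ (possibly $+\infty$). Estimator $\widehat\mu_\delta$: let $m=\lfloor n/2\rfloor$, $k=\lceil 720\log(1/\delta)\rceil$, $p=k/(m+1)$, $J_p=\max\{j\in\{0,1,2,\dots\}:2^jp\le1/4\}$. Split the data into $\mathcal D_m=(X_1,\dots,X_m)$ and the hold-out set $\mathcal D_m'=(X_1',\dots,X_m')$ with $X_i'=X_{m+i}$; let $X_{(1)}\le\dots\le X_{(m)}$ and $X'_{(1)}\le\dots\le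 X'_{(m)}$ be the respective order statistics. For $j=0,\dots,J_p$ define $$\widehat\ell_j=\tfrac12\big[(X'_{(2^{j+1}k)}-X'_{(2^jk)})+(X'_{(m+1-2^jk)}-X'_{(m+1-2^{j+1}k)})\big],\quad \widehat w_j=\frac{2^j}{\widehat\ell_j^{\,2}},\quad \widehat\lambda_j=\frac{\widehat w_j}{\sum_{t=0}^{J_p}\widehat w_t},$$ $$M_{2^jk}=\tfrac12\big(X_{(2^jk)}+X_{(m+1-2^jk)}\big),\qquad \widehat\mu_\delta=\sum_{j=0}^{J_p}\widehat\lambda_j\,M_{2^jk}.$$ (The estimator is defined when $m\ge 4k$.) *)

(* Defs.v *)
From HB Require Import structures.
From mathcomp Require Import all_boot all_order all_algebra.
From mathcomp Require Import all_classical all_reals all_analysis.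
Import Order.TTheory GRing.Theory Num.Theory.
Import numFieldNormedType.Exports.

Set Implicit Arguments.
Unset Strict Implicit.
Unset Printing Implicit Defensive.

Local Open Scope classical_set_scope.
Local Open Scope ring_scope.

Section densities.
Variable R : realType.
Implicit Types (f g : R -> R).

Definition translate f (mu : R) : R -> R := fun x => f (x - mu).

Definition density_cdf f (x : R) : R :=
  \int[lebesgue_measure]_(y in `]-oo, x]) f y.

Definition hazard f (x : R) : R := f x / (1 - density_cdf f x).

Record is_density f : Prop := IsDensity {
  density_measurable : measurable_fun setT f ;
  density_ge0 : forall x, 0 <= f x ;
  density_integral : (\int[lebesgue_measure]_x (f x)%:E = 1)%E }.

(* Symmetric unimodal densities with monotone hazard rate. *)
Record SUMHR f : Prop := IsSUMHR {
  sumhr_density : is_density f ;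
  sumhr_sym : forall x, f (- x) = f x ;
  sumhr_unimodal : forall x y : R, 0 <= x -> x <= y -> f y <= f x ;
  sumhr_hazard : forall x y : R, interior [set z | 0 < f z] x ->
    interior [set z | 0 < f z] y -> x <= y -> hazard f x <= hazard f y }.

Definition hellinger2 f g : \bar R :=
  ((2^-1)%:E * \int[lebesgue_measure]_x
     ((Num.sqrt (f x) - Num.sqrt (g x)) ^+ 2)%:E)%E.

(* The supremum is taken in [\bar R] and may be +oo; the formula is used for
   every real [t], and yields +oo for [1 <= t] since [hellinger2] of two
   densities is at most 1. *)
Definition hellinger_modulus f (t : R) : \bar R :=
  ereal_sup [set r%:E | r in
    [set r : R | 0 <= r /\
       (hellinger2 (translate f 0) (translate f (2 * r)) <= t%:E)%E]].

End densities.

Section iid.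
Variables (d : measure_display) (T : measurableType d) (R : realType).
Variables (P : probability T R) (n : nat) (X : 'I_n -> {RV P >-> R}).

Definition has_density (Y : {RV P >-> R}) (g : R -> R) : Prop :=
  forall A : set R, measurable A ->
    distribution P Y A = (\int[lebesgue_measure]_(x in A) (g x)%:E)%E.

Definition mutually_independent : Prop :=
  forall (J : {set 'I_n}) (A : 'I_n -> set R),
    (forall i, measurable (A i)) ->
    (P (\bigcap_(i in [set i | i \in J]) (X i @^-1` A i)) =
     \prod_(i in J) P (X i @^-1` A i))%E.

Definition iid_sample (g : R -> R) : Prop :=
  mutually_independent /\ forall i, has_density (X i) g.

End iid.

Section estimator.
Variable R : realType.

(* [order_stat s i] is the [i]-th smallest entry of [s], counted from 1; it is
   meaningful for [1 <= i <= size s]. *)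
Definition order_stat (s : seq R) (i : nat) : R :=
  nth 0 (sort <=%O s) i.-1.

Variables (delta : R) (n : nat) (x : n.-tuple R).

Definition half_size : nat := n./2.
Local Notation m := half_size.

Definition tail_rank : nat := `|Num.ceil (720 * ln (1 / delta))|%N.
Local Notation k := tail_rank.

Definition tail_level : R := k%:R / m.+1%:R.

(* For [0 < k], [2 ^+ j * k / m.+1 <= 1/4] forces [j < m.+1], so that bounding
   the range loses nothing; the set of admissible [j] is nonempty as soon as
   [4 * k <= m], the regime in which the estimator is meaningful. *)
Definition max_level : nat :=
  (\max_(j < m.+1 | (2 ^+ j * tail_level <= 4^-1)%R) (j : nat))%N.

Definition main_sample : seq R := take m x.

(* When [n] is odd the last observation is discarded. *)
Definition holdout_sample : seq R := take m (drop m x).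

Definition tail_spacing (j : nat) : R :=
  2^-1 * ((order_stat holdout_sample (2 ^ j.+1 * k)
             - order_stat holdout_sample (2 ^ j * k))
          + (order_stat holdout_sample (m.+1 - 2 ^ j * k)
             - order_stat holdout_sample (m.+1 - 2 ^ j.+1 * k))).

Definition weight (j : nat) : R := 2 ^+ j / tail_spacing j ^+ 2.

Definition norm_weight (j : nat) : R :=
  weight j / \sum_(t < max_level.+1) weight t.

Definition midsummary (r : nat) : R :=
  2^-1 * (order_stat main_sample r + order_stat main_sample (m.+1 - r)).

Definition mu_hat : R :=
  \sum_(j < max_level.+1) norm_weight j * midsummary (2 ^ j * k).

End estimator.

(* Main.v *)
(* Let [S] be the upper tail of [f], [q] its inverse, [s_j = 2 ^ j * k / (m + 1)]
   and [g_j = s_j / f (q s_j)].  On the right half line [f] decreases while [f / S]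
   increases, so that
     |q s' - q s + (s' - s) / f (q s)| <= (s' - s) ^ 2 / (f (q s) * s'),
   and [L_j = q s_j - q s_(j+1)] lies in [[g_j / 2, g_j]].  Over a distance [2 r]
   the relative variation of the root density at tail level [s_j] is at most of
   order [r / L_j]; summing over the dyadic shells, and counting the mass beyond
   [q s_1] in full, gives
     H ^ 2 (f_0, f_(2r)) <= C * (p + p * r ^ 2 * \sum_j 2 ^ j / g_j ^ 2).
   It therefore suffices to bound the error by a multiple of [I^-1], where
   [I ^ 2 = \sum_j 2 ^ j / g_j ^ 2].

   An order statistic lies above [q s] when the number of observations beyond
   [q s] reaches its rank.  Controlling these binomial counts at [q s_j] and their
   increments on a fine grid around it linearises both order statistics of rank
   [2 ^ j * k] from the ends: up to [g_j * 2 ^ (-5j/8)], the midsummary error is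
   [g_j / 2] times the normalised difference of the counts in the two tails,
   itself at most [2 ^ (-3j/8)].  The hold-out spacings are within
   [g_j * 2 ^ (-3j/8)] of [L_j], so replacing the random weights by [2 ^ j / L_j ^ 2]
   changes the weighted sum by at most a multiple of [I], while the weights add up
   to at least [I ^ 2 / 4].  What is left in the numerator is one fixed linear
   combination of the tail counts, whose exponential moment is controlled by
   a Schur test.  Since the good event is described by counts alone, a union bound
   suffices and the independence of the two half samples is never used. *)
Require Import Defs.
From HB Require Import structures.
From mathcomp Require Import all_boot all_order all_algebra.
From mathcomp Require Import all_classical all_reals all_analysis measurable_realfun.
From mathcomp Require Import ring lra zify.
Import Order.TTheory GRing.Theory Num.Theory.
Import numFieldNormedType.Exports.
Local Open Scope classical_set_scope.
Local Open Scope ring_scope.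

(** * Deviation of empirical counts *)

Section Chernoff.
Context {d : measure_display} {T : measurableType d} {R : realType}.
Variable P : probability T R.

Lemma le_finite_union (I : finType) (F : I -> set T) (E : set T) :
  measurable E -> (forall i, measurable (F i)) -> E `<=` \bigcup_i F i ->
  (P E <= \sum_i P (F i))%E.
Proof.
move=> mE mF EF.
(* [content_subadditive] speaks of sequences of sets, so the family is enumerated along [enum_val]
   and padded with the empty set. *)
pose G : nat -> set T := fun k =>
  if insub k is Some j then F (enum_val (j : 'I_#|I|)) else set0.
have GE (j : 'I_#|I|) : G j = F (enum_val j).
  by rewrite /G; case: insubP => [k _ /val_inj ->//|]; rewrite ltn_ord.
have mG k : measurable (G k).
  by rewrite /G; case: insub => [j|//]; exact: mF.
apply: (@le_trans _ _ (\sum_(j < #|I|) P (G j))%E).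
  apply: content_subadditive => //; apply: (subset_trans EF).
  move=> x [i _ Fi]; rewrite -bigcup_mkord; exists (enum_rank i) => //=.
  by rewrite GE enum_rankK.
rewrite (reindex (@enum_rank I)) /=; last first.
  by exists enum_val => i _; [exact: enum_rankK | exact: enum_valK].
by apply: lee_sum => i _; rewrite GE enum_rankK.
Qed.

Lemma measure_finite_disjoint (K : finType) (c : T -> K) (Q : pred K) :
  (forall k, measurable [set w | c w = k]) ->
  P [set w | Q (c w)] = (\sum_(k | Q k) P [set w | c w = k])%E.
Proof.
move=> mc.
have -> : [set w | Q (c w)] = \bigcup_(k in [set k | Q k]) [set w | c w = k].
  apply/seteqP; split => w /=; first by move=> Qw; exists (c w).
  by case=> k /= Qk ->.
rewrite measure_fin_bigcup//.
- rewrite (bigfs _ (r := index_enum K) (P := Q))//; first exact: index_enum_uniq.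
  by move=> k _; rewrite mem_index_enum.
- exact: finite_finset.
- by apply/trivIsetP => i j _ _ ij; apply/seteqP; split => w //= [-> /eqP]; rewrite (negbTE ij).
Qed.

(** For x <= 0, e^(-x) >= 1 - x and (1 - x)(1 + x + x^2) = 1 - x^3 >= 1. For x >= 0 the difference
    has derivative 1 + 2y - e^y, nonnegative on [0, 1] because e^y lies below its chord and e <=
    3. *)
Lemma expR_le1Dx_sqr (x : R) : `|x| <= 1 -> expR x <= 1 + x + x ^+ 2.
Proof.
rewrite ler_norml => /andP[xgeN1 xle1].
(* From e^(-1/8) >= 7/8 follows e <= (8/7)^8 < 3. *)
have e3 : expR 1 <= 3 :> R.
  have h : expR (8^-1 : R) <= 8 / 7.
    have := expR_ge1Dx (- (8^-1 : R)); rewrite expRN => h.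
    have e0 := expR_gt0 (8^-1 : R).
    rewrite -[leLHS]invrK -[leRHS]invrK lef_pV2 ?posrE ?invr_gt0//; lra.
  rewrite (_ : 1 = 8%:R * 8^-1)//; last by lra.
  rewrite expRM_natl.
  apply: (@le_trans _ _ ((8 / 7) ^+ 8)); last by lra.
  by rewrite lerXn2r// ?nnegrE ?expR_ge0//; lra.
have chord (y : R) : 0 <= y -> y <= 1 -> expR y <= 1 + 2 * y.
  move=> y0 y1.
  have := @convex_expR R (Itv01 y0 y1) 1 0.
  rewrite !convRE/= expR0 /unstable.onem mulr1 mulr0 addr0 mulr1 => hh.
  have := ler_wpM2l y0 e3; lra.
have [x0|x0] := leP x 0.
  have h := expR_ge1Dx (- x).
  have e0 := expR_gt0 x.
  move: h; rewrite expRN => h.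
  have : expR x * (1 - x) <= 1.
    by rewrite -[leRHS](mulfV (lt0r_neq0 e0)) ler_pM2l.
  nra.
pose g (y : R) : R := 1 + y + y ^+ 2 - expR y.
have [| |c] := @MVT R g (fun y => 1 + 2 * y - expR y) 0 x x0.
- move=> y _; rewrite /g.
  apply: is_derive_eq.
  by rewrite !scaler1; ring.
- have cg : continuous g; last exact: continuous_subspaceT.
  move=> y; apply: cvgB; last exact: continuous_expR.
  by apply: cvgD; [apply: cvgD; [exact: cvg_cst|exact: cvg_id]|exact: exprn_continuous].
rewrite in_itv/= => /andP[c0 cx]; rewrite /g expR0.
have := chord c (ltW c0) (ltW (lt_le_trans cx xle1)) => hc.
rewrite expr0n/= => h.
have : 0 <= (1 + 2 * c - expR c) * (x - 0) by apply: mulr_ge0; lra.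
rewrite -h; lra.
Qed.

(** Exponential Markov inequality for a linear combination of counts in possibly overlapping sets.
    The bound on the sum of the [|c b|] makes the quadratic bound on the exponential applicable. The
    combination is not centered: its mean is to be absorbed in [tau]. Only the membership pattern of
    each observation matters, so every expectation is a finite sum over patterns. *)
Lemma chernoff {m : nat} (Z : 'I_m -> {RV P >-> R}) (B : finType)
    (A : B -> set R) (c s : B -> R) (s2 : B -> B -> R) (tau : R) :
  mutually_independent Z -> (forall b, measurable (A b)) ->
  \sum_b `|c b| <= 1 ->
  (forall i b, P (Z i @^-1` A b) = (s b)%:E) ->
  (forall i b b', P (Z i @^-1` (A b `&` A b')) = (s2 b b')%:E) ->
  (P [set w | (tau <= \sum_i \sum_b c b * (Z i w \in A b)%:R)%R]
   <= (expR (m%:R * (\sum_b c b * s b + \sum_b \sum_b' c b * c b' * s2 b b')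
             - tau))%:E)%E.
Proof.
move=> indZ mA c1 sE s2E.
pose code (x : R) : {ffun B -> bool} := [ffun b => x \in A b].
pose cell (k : {ffun B -> bool}) : set R := [set x | code x = k].
pose G (k : {ffun B -> bool}) : R := \sum_b c b * (k b)%:R.
have mcell k : measurable (cell k).
  have -> : cell k = \bigcap_b (if k b then A b else ~` A b).
    apply/seteqP; split => [x /= <- b _|x /= h].
      by rewrite ffunE; case: ifPn; rewrite ?inE// notin_setE.
    apply/ffunP => b; rewrite ffunE; have := h b I.
    by case: (k b) => [/mem_set//|]; apply: memNset.
  apply: fin_bigcap_measurable; first exact: finite_finset.
  by move=> b _; case: ifP => _ //; apply: measurableC.
have mZ i (S : set R) : measurable S -> measurable (Z i @^-1` S).
  by move=> mS; rewrite -[X in measurable X]setTI; exact: measurable_funP.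
pose pr i k : R := fine (P (Z i @^-1` cell k)).
have prE i k : P (Z i @^-1` cell k) = (pr i k)%:E.
  by rewrite /pr fineK// fin_num_measure//; exact: mZ.
have pr0 i k : 0 <= pr i k by rewrite /pr fine_ge0.
(* An event determined by the pattern has probability a sum over cells; the moments [s] and [s2] are
   read off this identity. *)
have prQ i (Q : pred {ffun B -> bool}) :
    (\sum_(k | Q k) pr i k)%:E = P [set w | Q (code (Z i w))].
  rewrite (@measure_finite_disjoint _ (code \o Z i) Q); last first.
    by move=> k; exact: (mZ i _ (mcell k)).
  rewrite -sumEFin; apply: eq_bigr => k _; rewrite -prE//.
have pr1 i : \sum_k pr i k = 1.
  apply: EFin_inj; rewrite (prQ i xpredT) -(probability_setT P).
  by congr (P _); apply/seteqP.
have prA i b : \sum_(k : {ffun B -> bool}) (k b)%:R * pr i k = s b.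
  apply: EFin_inj; rewrite -(sE i).
  pose Q : pred {ffun B -> bool} := fun k => k b.
  have -> : Z i @^-1` A b = [set w | Q (code (Z i w))].
    by apply/seteqP; split => w /=; rewrite /Q ffunE inE.
  rewrite -(prQ i Q); congr EFin; rewrite [RHS]big_mkcond; apply: eq_bigr => k _.
  by rewrite /Q; case: (k b); rewrite ?mul1r ?mul0r.
have prA2 i b b' : \sum_(k : {ffun B -> bool}) (k b)%:R * (k b')%:R * pr i k = s2 b b'.
  apply: EFin_inj; rewrite -(s2E i).
  pose Q : pred {ffun B -> bool} := fun k => k b && k b'.
  have -> : Z i @^-1` (A b `&` A b') = [set w | Q (code (Z i w))].
    apply/seteqP; split => w /=; rewrite /Q !ffunE.
      by case=> ? ?; apply/andP; rewrite !inE.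
    by move=> /andP[]; rewrite !inE.
  rewrite -(prQ i Q); congr EFin; rewrite [RHS]big_mkcond; apply: eq_bigr => k _.
  by rewrite /Q; case: (k b); case: (k b'); rewrite ?(mul1r,mul0r).
set V := \sum_b c b * s b + _.
(* E exp G <= 1 + E G + E G^2 = 1 + V <= exp V, since |G| <= 1. *)
have mgf i : \sum_k expR (G k) * pr i k <= expR V.
  apply: (@le_trans _ _ (1 + V)); last exact: expR_ge1Dx.
  apply: (@le_trans _ _ (\sum_k (1 + G k + G k ^+ 2) * pr i k)).
    apply: ler_sum => k _; apply: ler_wpM2r => //; apply: expR_le1Dx_sqr.
    apply: le_trans c1; apply: (le_trans (ler_norm_sum _ _ _)).
    apply: ler_sum => b _; rewrite normrM; apply: ler_piMr => //.
    by case: (k b); rewrite ?normr1 ?normr0.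
  under eq_bigr do rewrite !mulrDl mul1r.
  rewrite !big_split/= pr1 /V -addrA lerD2l lerD//.
    under eq_bigr do rewrite mulr_suml.
    rewrite exchange_big/=; apply: ler_sum => b _.
    under eq_bigr do rewrite -mulrA.
    by rewrite -mulr_sumr prA.
  under eq_bigr do rewrite expr2 mulr_suml mulr_suml.
  rewrite exchange_big/=; apply: ler_sum => b _.
  under eq_bigr do rewrite mulr_sumr mulr_suml.
  rewrite exchange_big/=; apply: ler_sum => b' _.
  rewrite -(prA2 i) mulr_sumr; apply: ler_sum => k _.
  by rewrite le_eqVlt; apply/orP; left; apply/eqP; ring.
(* The event is split according to the patterns of all observations. On each admissible assignment
   the factor exp(sum of G - [tau]) is at least 1; extending the bound to all assignments lets the
   sum factorise over the observations. *)
pose good (be : {ffun 'I_m -> {ffun B -> bool}}) := tau <= \sum_i G (be i).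
pose F (be : {ffun 'I_m -> {ffun B -> bool}}) : set T :=
  if good be then \bigcap_(i in [set i | i \in [set: 'I_m]%SET])
    (Z i @^-1` cell (be i)) else set0.
have mF be : measurable (F be).
  rewrite /F; case: ifP => // _; apply: fin_bigcap_measurable.
    exact: finite_finset.
  by move=> i _; apply: mZ.
have PF be : (P (F be) <= (expR (\sum_i G (be i) - tau) * \prod_i pr i (be i))%:E)%E.
  rewrite /F; case: ifPn => [gb|_]; last first.
    by rewrite measure0 lee_fin mulr_ge0 ?expR_ge0// prodr_ge0.
  rewrite indZ//.
  have -> : (\prod_(i in [set: 'I_m]%SET) P (Z i @^-1` cell (be i)))%E =
      (\prod_i pr i (be i))%:E.
    rewrite -prodEFin; apply: eq_big => [i|i _]; first by rewrite finset.in_setT.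
    by rewrite prE.
  rewrite lee_fin; apply: ler_peMl; first by rewrite prodr_ge0.
  by rewrite -expR0 ler_expR subr_ge0.
have EF : [set w | tau <= \sum_i \sum_b c b * (Z i w \in A b)%:R] = \bigcup_be F be.
  have Gw w : \sum_i \sum_b c b * (Z i w \in A b)%:R = \sum_i G (code (Z i w)).
    by apply: eq_bigr => i _; apply: eq_bigr => b _; rewrite ffunE.
  apply/seteqP; split => w /=; rewrite Gw.
    move=> hw; exists [ffun i => code (Z i w)] => //; rewrite /F.
    rewrite (_ : good _ = true); first by move=> i _ /=; rewrite /cell/= ffunE.
    by rewrite /good (le_trans hw)// le_eqVlt; apply/orP; left; apply/eqP; apply: eq_bigr => i _; rewrite ffunE.
  case=> be _; rewrite /F; case: ifPn => // gb h.
  apply: (le_trans gb); rewrite le_eqVlt; apply/orP; left; apply/eqP; apply: eq_bigr => i _.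
  by rewrite (h i)//= finset.in_setT.
rewrite EF; apply: (le_trans (@le_finite_union _ F _ _ mF (@subset_refl _ _))).
  by apply: fin_bigcup_measurable; [exact: finite_finset|move=> be _; exact: mF].
apply: (le_trans (lee_sum _ (fun be _ => PF be))).
rewrite sumEFin lee_fin.
have -> : \sum_(be : {ffun 'I_m -> {ffun B -> bool}}) expR (\sum_i G (be i) - tau) * \prod_i pr i (be i)
   = expR (- tau) * \prod_(i < m) \sum_k expR (G k) * pr i k.
  rewrite bigA_distr_bigA/= mulr_sumr; apply: eq_bigr => be _.
  by rewrite big_split/= -expR_sum addrC expRD mulrA.
rewrite addrC expRD ler_wpM2l ?expR_ge0// expRM_natl.
rewrite -[X in _ ^+ X](card_ord m) -prodr_const; apply: ler_prod => i _.
by rewrite mgf andbT sumr_ge0// => k _; rewrite mulr_ge0 ?expR_ge0.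
Qed.

Definition hits {m : nat} (Z : 'I_m -> {RV P >-> R}) (A : set R) (w : T) : R :=
  \sum_i (Z i w \in A)%:R.

Lemma measurable_hits {m : nat} (Z : 'I_m -> {RV P >-> R}) (A : set R) :
  measurable A -> measurable_fun setT (hits Z A).
Proof.
move=> mA; apply: measurable_sum => i.
rewrite (_ : (fun w => _) = \1_A \o Z i); last by apply/funext => w; rewrite /= indicE.
apply: measurableT_comp => //.
Qed.

Lemma measurable_superlevel (h : T -> R) (a : R) :
  measurable_fun setT h -> measurable [set w | a <= h w].
Proof.
move=> /(_ measurableT _ (measurable_itv `[a, +oo[)); rewrite setTI.
congr (measurable _); apply/seteqP; split => w /=; by rewrite in_itv/= andbT.
Qed.

Lemma hits_deviation {m : nat} (Z : 'I_m -> {RV P >-> R}) (A : set R)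
    (sigma sbar eta : R) :
  mutually_independent Z -> measurable A ->
  (forall i, P (Z i @^-1` A) = sigma%:E) ->
  (0 < m)%N -> sigma <= sbar -> 0 < sbar -> 0 <= eta -> eta <= 2 * m%:R * sbar ->
  (P [set w | (eta <= `|hits Z A w - m%:R * sigma|)%R] <=
   (2 * expR (- (eta ^+ 2 / (4 * m%:R * sbar))))%:E)%E.
Proof.
move=> indZ mA PA m0 ss sb0 eta0 etale.
have mR : 0 < m%:R :> R by rewrite ltr0n.
have msb : 0 < m%:R * sbar by rewrite mulr_gt0.
(* Minimiser of la^2 * m * sbar - la * eta, with value - eta^2 / (4 * m * sbar); the upper bound on
   [eta] makes it at most 1. *)
pose la : R := eta / (2 * m%:R * sbar).
have la0 : 0 <= la by rewrite divr_ge0// -mulrA mulr_ge0// ltW.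
have la1 : la <= 1 by rewrite ler_pdivrMr ?mul1r// -mulrA mulr_gt0.
have key (e : R) : `|e| = 1 ->
    (P [set w | (la * eta + e * la * (m%:R * sigma) <=
                 \sum_i \sum_(b : unit) e * la * (Z i w \in A)%:R)%R]
     <= (expR (- (eta ^+ 2 / (4 * m%:R * sbar))))%:E)%E.
  move=> e1.
  have e2 : e ^+ 2 = 1 by rewrite -real_normK ?num_real// e1 expr1n.
  have h := @chernoff _ Z unit (fun=> A) (fun=> e * la) (fun=> sigma) (fun _ _ => sigma)
    (la * eta + e * la * (m%:R * sigma)) indZ (fun=> mA).
  apply: (le_trans (h _ _ _)).
  - by rewrite big_const card_unit/= addr0 normrM e1 mul1r ger0_norm.
  - by move=> i _; exact: PA.
  - by move=> i _ _; rewrite setIid; exact: PA.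
  - rewrite lee_fin ler_expR !big_const !card_unit/= !addr0.
    have -> : e * la * (e * la) = la ^+ 2 by rewrite -[RHS]mul1r -e2; ring.
    have -> : m%:R * (e * la * sigma + la ^+ 2 * sigma) - (la * eta + e * la * (m%:R * sigma))
      = la ^+ 2 * (m%:R * sigma) - la * eta by ring.
    apply: (@le_trans _ _ (la ^+ 2 * (m%:R * sbar) - la * eta)).
      by rewrite lerB// ler_wpM2l ?sqr_ge0// ler_wpM2l// ltW.
    rewrite le_eqVlt; apply/orP; left; apply/eqP; rewrite /la; field.
    by rewrite !gt_eqF.
have mh := measurable_hits Z A mA.
have mS (e a : R) : measurable [set w | a <= e * la * hits Z A w].
  apply: measurable_superlevel; apply: measurable_funM => //.
have mD : measurable [set w | eta <= `|hits Z A w - m%:R * sigma|].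
  apply: measurable_superlevel.
  by apply: measurableT_comp => //; apply: measurable_funB.
have sumE e w : \sum_(i < m) \sum_(b : unit) e * la * (Z i w \in A)%:R = e * la * hits Z A w.
  rewrite /hits mulr_sumr; apply: eq_bigr => i _.
  by rewrite big_const card_unit/= addr0.
apply: (le_trans (@le_finite_union bool (fun b => [set w | la * eta + (-1) ^+ b * la * (m%:R * sigma) <=
                 (-1) ^+ b * la * hits Z A w]) _ mD _ _)).
- by move=> b; exact: mS.
- move=> w /=; rewrite ler_normr => /orP[h|h]; [exists false|exists true] => //=.
    by rewrite expr0 mul1r -lerBrDr -mulrBr ler_wpM2l.
  rewrite expr1 -lerBrDr -mulrBr mulN1r mulNr -mulrN opprB; apply: ler_wpM2l => //.
  by rewrite -opprB.
- rewrite big_bool/= mulrDl mul1r EFinD.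
  apply: leeD.
    have := key (-1) (normrN1 _).
    by under eq_set do rewrite sumE; rewrite expr1.
  have := key 1 (normr1 _).
  by under eq_set do rewrite sumE; rewrite expr0.
Qed.

End Chernoff.

(** * Order statistics *)

Section OrderStatistics.
Context {R : realType}.

Lemma order_stat_leE (s : seq R) (i : nat) (a : R) : (0 < i <= size s)%N ->
  (order_stat s i <= a) = (i <= count (fun v => v <= a)%R s)%N.
Proof.
case/andP=> i0 is_; rewrite /order_stat.
have so : sorted <=%O (sort <=%O s) by exact: sort_le_sorted.
have cs : count (fun v => v <= a) s = count (fun v => v <= a) (sort <=%O s).
  by apply/esym; exact/permP/permPl/perm_sort.
rewrite cs; apply/idP/idP => h.
  rewrite leqNgt; apply/negP => lt.
  have : a < nth 0 (sort <=%O s) i.-1.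
    apply: nth_count_gt => //; rewrite size_sort; apply/andP; split; last by rewrite prednK.
    by rewrite -ltnS prednK.
  by rewrite ltNge h.
by apply: nth_count_le => //; rewrite prednK.
Qed.

Variables (m : nat) (y : 'I_m -> R).
Let z := [seq y i | i <- enum 'I_m].

Lemma count_family (a : pred R) (A : set R) : (forall v, (v \in A) = a v) ->
  \sum_i (y i \in A)%:R = (count a z)%:R :> R.
Proof.
move=> aE; rewrite /z count_map -sum1_count big_enum_cond/= natr_sum [RHS]big_mkcond.
by apply: eq_bigr => i _; rewrite aE/=; case: (a _).
Qed.

Lemma size_family : size z = m. Proof. by rewrite size_map size_enum_ord. Qed.

Lemma order_stat_le_hits (r : nat) (a : R) : (0 < r <= m)%N ->
  (order_stat z r <= a) = (r%:R <= \sum_i (y i \in [set v | v <= a])%:R :> R).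
Proof.
move=> rm; rewrite order_stat_leE ?size_family//.
by rewrite (@count_family (fun v => v <= a)) ?ler_nat// => v; apply/idP/idP; rewrite inE.
Qed.

(** Rank [m.+1 - r] from below is rank [r] from above, so this follows by counting the
    complement. *)
Lemma order_stat_gt_hits (r : nat) (a : R) : (0 < r <= m)%N ->
  (a < order_stat z (m.+1 - r)) = (r%:R <= \sum_i (y i \in [set v | a < v])%:R :> R).
Proof.
case/andP=> r0 rm; rewrite ltNge order_stat_leE ?size_family; last first.
  by rewrite subn_gt0 ltnS rm/= leq_subLR -addn1 addnC leq_add2r.
rewrite (@count_family (fun v => a < v)) ?ler_nat; last first.
  by move=> v; apply/idP/idP; rewrite inE.
have := count_predC (fun v => v <= a) z; rewrite size_family.
rewrite (@eq_count _ (predC (fun v => v <= a)) (fun v => a < v)); last first.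
  by move=> v; rewrite /= ltNge.
move: (count _ z) (count _ z) => p q.
rewrite -ltnNge; move=> e; apply/idP/idP; lia.
Qed.

End OrderStatistics.

(** * Measurability of order statistics, and independent subfamilies *)

Section MeasurableEstimator.
Context {d : measure_display} {T : measurableType d} {R : realType}.
Variable P : probability T R.

(** Inversion is discontinuous at 0, where its value is 0 by convention; written as the power of
    exponent -1, it is covered by the measurability of [powR]. *)
Lemma measurable_inv_ge0 (h : T -> R) : (forall w, 0 <= h w) ->
  measurable_fun setT h -> measurable_fun setT (fun w => (h w)^-1).
Proof.
move=> h0 mh; rewrite (_ : (fun w => _) = (@powR R ^~ (-1)) \o h); last first.
  by apply/funext => w; rewrite /= powR_inv1.
by apply: measurableT_comp => //; exact: measurable_powR.
Qed.

Lemma measurable_from_sublevel (h : T -> R) :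
  (forall a, measurable [set w | h w <= a]) -> measurable_fun setT h.
Proof.
move=> mh; apply: (measurability (@RGenOInfty.G R)) => [|/= _ [_] [r] -> <-].
  exact: RGenOInfty.measurableE.
apply: measurableI => //.
rewrite (_ : _ @^-1` _ = ~` [set w | h w <= r]); first exact: measurableC.
by apply/seteqP; split => w /=; rewrite in_itv/= andbT ltNge => /negP.
Qed.

Lemma measurable_order_stat (m : nat) (Z : 'I_m -> {RV P >-> R}) (r : nat) :
  (0 < r <= m)%N ->
  measurable_fun setT (fun w => order_stat [seq Z i w | i <- enum 'I_m] r).
Proof.
move=> rm; apply: measurable_from_sublevel => a.
under eq_set do rewrite (order_stat_le_hits _ (fun i => Z i _))//.
apply: measurable_superlevel; apply: measurable_hits.
rewrite -set_itvNyc; exact: measurable_itv.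
Qed.

Lemma take_drop_tuple (n l m : nat) (x : 'I_n -> R) (io : 'I_m -> 'I_n) :
  (l + m <= n)%N -> (forall i, io i = (l + i)%N :> nat) ->
  take m (drop l [tuple x i | i < n]) = [seq x (io i) | i <- enum 'I_m].
Proof.
move=> lmn ioE.
have sz : size (take m (drop l [tuple x i | i < n])) = m.
  by rewrite size_takel// size_drop size_tuple; lia.
apply: (@eq_from_nth _ 0).
  by rewrite sz size_map size_enum_ord.
rewrite sz => i im.
rewrite nth_take// nth_drop (nth_map (Ordinal im)) ?size_enum_ord//.
have lin : (l + i < n)%N by lia.
rewrite (_ : (l + i)%N = Ordinal lin :> nat)// -tnth_nth tnth_mktuple.
by congr x; apply: val_inj; rewrite /= ioE nth_enum_ord.
Qed.

Lemma independent_subfamily (n m : nat) (X : 'I_n -> {RV P >-> R}) (io : 'I_m -> 'I_n) :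
  injective io -> mutually_independent X ->
  mutually_independent (fun i => X (io i)).
Proof.
move=> ioI indX J A mA.
(* The sets are transported along [io], with default [setT] outside its image. *)
pose A' i := if [pick k | io k == i] is Some k then A k else setT.
have A'E k : A' (io k) = A k.
  rewrite /A'; case: pickP => [k' /eqP/ioI ->//|/(_ k)]; by rewrite eqxx.
have := indX (io @: J)%SET A'; rewrite big_imset/=; last by move=> ? ? _ _; exact: ioI.
under eq_bigr do rewrite A'E.
move=> <-; last by move=> i; rewrite /A'; case: pickP.
congr (P _); apply/seteqP; split => w /= h i /=.
  by move=> /imsetP[k kJ ->]; rewrite A'E; exact: h.
by move=> iJ; have := h (io i); rewrite /= A'E; apply; apply: imset_f.
Qed.

End MeasurableEstimator.

(** * Tails of a symmetric density with monotone hazard rate *)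

Section LebesgueIsometry.
Context {R : realType}.
Local Notation leb := (@lebesgue_measure R).

Variables (e a : R) (e1 : e = 1 \/ e = -1).
Let phi : measurableTypeR R -> measurableTypeR R := fun x => e * x + a.

Lemma measurable_isometry : measurable_fun setT phi.
Proof.
apply: measurable_funD => //; apply: measurable_funM => //.
Qed.

(** The pushforward agrees with Lebesgue measure on half-open intervals, hence everywhere by
    uniqueness. Reflections give the symmetry of the tail, translations the recentering at [mu] and
    the shift by 2 r. *)
Lemma lebesgue_measure_isometry (A : set R) : measurable A ->
  leb (phi @^-1` A) = leb A.
Proof.
move=> mA.
pose nu := measure_function_pushforward__canonical__measure_function_Measure leb measurable_isometry.
apply/esym; apply: (@lebesgue_measure_unique R nu) => // _ [[x y] _ <-].
rewrite /nu/= /pushforward.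
case: e1 => ee.
  rewrite (_ : phi @^-1` _ = `]x - a, y - a]%classic); last first.
    apply/seteqP; split => z /=; rewrite !in_itv/= /phi ee mul1r.
      by rewrite ltrBlDr lerBrDr.
    by rewrite ltrBlDr lerBrDr.
  by rewrite !lebesgue_measure_itv/= !lte_fin ltrD2r -!EFinB; congr (if _ then _ else _); congr EFin; ring.
rewrite (_ : phi @^-1` _ = `[a - y, a - x[%classic); last first.
  apply/seteqP; split => z /=; rewrite !in_itv/= /phi ee mulN1r => /andP[h1 h2]; apply/andP; lra.
rewrite !lebesgue_measure_itv/= !lte_fin ltrD2l ltrN2 -!EFinB; congr (if _ then _ else _); congr EFin; ring.
Qed.

Lemma integral_isometry (D : set R) (F : R -> R) : measurable D ->
  measurable_fun setT F -> (forall x, 0 <= F x) ->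
  (\int[leb]_(x in phi @^-1` D) (F (phi x))%:E = \int[leb]_(x in D) (F x)%:E)%E.
Proof.
move=> mD mF F0.
have h := @ge0_integral_pushforward _ _ _ _ R phi measurable_isometry leb D (EFin \o F) mD.
rewrite -h.
- by apply: eq_measure_integral => [|? A mA _]; [exact: measurable_isometry|exact: lebesgue_measure_isometry].
- by apply/measurable_EFinP; exact: measurable_funTS.
- by move=> y _ /=; rewrite lee_fin.
Qed.

End LebesgueIsometry.

(** * The upper tail function *)

Section Tail.
Context {R : realType}.
Variables (f : R -> R) (hf : SUMHR f).
Local Notation leb := (@lebesgue_measure R).

Definition mass (A : set R) : R := fine (\int[leb]_(y in A) (f y)%:E)%E.
Definition tail (x : R) : R := mass `]x, +oo[.

Lemma sumhr_measurable : measurable_fun setT f.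
Proof. by case: hf => -[]. Qed.

Lemma sumhr_ge0 x : 0 <= f x.
Proof. by case: hf => -[]. Qed.

Let mfE (A : set R) : measurable_fun A (EFin \o f).
Proof. by apply/measurable_EFinP; apply: measurable_funTS; exact: sumhr_measurable. Qed.

Let f0E x : (0 <= (f x)%:E)%E.
Proof. by rewrite lee_fin sumhr_ge0. Qed.

Lemma massE (A : set R) : measurable A -> (\int[leb]_(y in A) (f y)%:E = (mass A)%:E)%E.
Proof.
move=> mA; rewrite /mass fineK//. rewrite ge0_fin_numE ?integral_ge0//.
 apply: (@le_lt_trans _ _ 1%E); last exact: ltry.
case: hf => -[_ _ <- _ _ _].
by apply: ge0_subset_integral => //; exact: mfE.
Qed.

Lemma mass_setT : mass setT = 1.
Proof. by rewrite /mass; case: hf => -[_ _ -> _ _ _]. Qed.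

Lemma mass_ge0 (A : set R) : 0 <= mass A.
Proof. by rewrite /mass fine_ge0// integral_ge0. Qed.

Lemma massU (A B : set R) : measurable A -> measurable B -> [disjoint A & B] ->
  mass (A `|` B) = mass A + mass B.
Proof.
move=> mA mB AB; apply: EFin_inj.
by rewrite EFinD -!massE//; [apply: ge0_integral_setU => //; exact: mfE|exact: measurableU].
Qed.

Lemma tail_sub x y : x <= y -> tail x - tail y = mass `]x, y].
Proof.
move=> xy; rewrite /tail (_ : [set` `]x, +oo[] = `]x, y] `|` `]y, +oo[); last first.
  apply/seteqP; split => z /=; rewrite !in_itv/= ?andbT.
    by move=> xz; have [zy|yz] := leP z y; [left; rewrite xz|right].
  by case=> [/andP[]//|]; exact: le_lt_trans.
rewrite massU ?addrK//.
apply/disj_set2P/seteqP; split => z //=; rewrite !in_itv/= andbT => -[/andP[_ zy]].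
by rewrite ltNge zy.
Qed.

Lemma mass_itv_le x y M : x <= y -> (forall z, x < z <= y -> f z <= M) ->
  mass `]x, y] <= M * (y - x).
Proof.
move=> xy fM; rewrite -lee_fin -massE//.
have := lebesgue_measure_itv `]x, y]; rewrite /= lte_fin => ley.
have [xy'|xy'] := ltP x y; last first.
  have -> : x = y by apply/eqP; rewrite eq_le xy xy'.
  by rewrite set_itv_ge/= ?bnd_simp ?ltxx// integral_set0 subrr mulr0.
move: ley; rewrite xy' -EFinB => ley; rewrite EFinM -ley -integral_cst//.
apply: ge0_le_integral => //=.
- exact: mfE.
Qed.

Lemma mass_itv_ge x y M : x <= y -> 0 <= M -> (forall z, x < z <= y -> M <= f z) ->
  M * (y - x) <= mass `]x, y].
Proof.
move=> xy M0 fM; rewrite -lee_fin -massE//.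
have := lebesgue_measure_itv `]x, y]; rewrite /= lte_fin => ley.
have [xy'|xy'] := ltP x y; last first.
  have -> : x = y by apply/eqP; rewrite eq_le xy xy'.
  by rewrite set_itv_ge/= ?bnd_simp ?ltxx// integral_set0 subrr mulr0.
move: ley; rewrite xy' -EFinB => ley; rewrite EFinM -ley -integral_cst//.
apply: ge0_le_integral => //=.
- exact: mfE.
Qed.

Lemma sumhr_norm x : f `|x| = f x.
Proof.
by have [//|x0] := ger0P x; case: hf => _ fs _ _; rewrite fs.
Qed.

Lemma sumhr_le x y : `|x| <= `|y| -> f y <= f x.
Proof.
move=> xy; rewrite -(sumhr_norm x) -(sumhr_norm y).
by case: hf => _ _ fu _; apply: fu.
Qed.

Lemma tail_nincr x y : x <= y -> tail y <= tail x.
Proof. by move=> xy; rewrite -subr_ge0 tail_sub// mass_ge0. Qed.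

Lemma tail_ge0 x : 0 <= tail x. Proof. exact: mass_ge0. Qed.

Lemma tail_lip x y : x <= y -> tail x - tail y <= f 0 * (y - x).
Proof.
by move=> xy; rewrite tail_sub// mass_itv_le// => z _; rewrite sumhr_le// normr0.
Qed.

Lemma tail_sub_le x y : 0 <= x -> x <= y -> tail x - tail y <= f x * (y - x).
Proof.
move=> x0 xy; rewrite tail_sub// mass_itv_le// => z /andP[xz zy].
by rewrite sumhr_le// ger0_norm// ger0_norm ?(le_trans x0)// ltW.
Qed.

(** The density is at least [f w] on [-w, w]. The points may lie on either side of 0, as happens at
    tail levels above 1/2. *)
Lemma tail_sub_ge x y w : x <= y -> `|x| <= w -> `|y| <= w ->
  f w * (y - x) <= tail x - tail y.
Proof.
move=> xy xw yw; rewrite tail_sub// mass_itv_ge ?sumhr_ge0// => z /andP[xz zy].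
move: xw yw; rewrite !ler_norml => /andP[xw _] /andP[_ yw].
rewrite sumhr_le// [leRHS]ger0_norm; last by lra.
by rewrite ler_norml; apply/andP; lra.
Qed.

Lemma mass_Ny x : mass `]-oo, x] = 1 - tail x.
Proof.
rewrite -mass_setT (_ : setT = `]-oo, x] `|` `]x, +oo[); last first.
  apply/seteqP; split => z //= _; rewrite !in_itv/= andbT.
  by apply/orP; case: leP.
rewrite massU// ?addrK//.
apply/disj_set2P/seteqP; split => z //=; rewrite !in_itv/= andbT => -[zy].
by rewrite ltNge zy.
Qed.

Lemma tail_opp x : tail (- x) = 1 - tail x.
Proof.
rewrite -mass_Ny /tail /mass; congr fine.
rewrite -integral_itv_bndo_bndc; last exact: mfE.
rewrite -(@integral_isometry R (-1) 0 (or_intror erefl) `]-oo, x[%classic f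
  (measurable_itv _) sumhr_measurable sumhr_ge0).
rewrite (_ : _ @^-1` `]-oo, x[ = `]-x, +oo[%classic).
  apply: eq_integral => z _; rewrite mulN1r addr0.
  by case: hf => _ -> _ _.
by apply/seteqP; split => z /=; rewrite !in_itv/= andbT mulN1r addr0 ltrNl.
Qed.

Lemma tail0 : tail 0 = 2^-1.
Proof. have := tail_opp 0; rewrite oppr0; lra. Qed.

Lemma continuous_tail : continuous tail.
Proof.
move=> x; apply/cvgrPdist_lt => e e0.
(* The tail is Lipschitz with constant [f 0]; adding 1 keeps the divisor positive. *)
have f1 : 0 < f 0 + 1 by rewrite ltr_wpDl ?sumhr_ge0.
near=> y.
have : `|x - y| < e / (f 0 + 1).
  by near: y; apply: (@cvgr_dist_lt _ _ _ _ _ id) => //; rewrite divr_gt0.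
rewrite ltr_pdivlMr//; apply: le_lt_trans.
have [xy|yx] := leP x y.
- rewrite ger0_norm ?subr_ge0 ?tail_nincr// (le_trans (tail_lip _ _ xy))//.
  rewrite (distrC x) ger0_norm ?subr_ge0// mulrC ler_wpM2l ?subr_ge0//; lra.
- rewrite (distrC (tail x)) ger0_norm; last by rewrite subr_ge0 tail_nincr// ltW.
  rewrite (le_trans (tail_lip _ _ (ltW yx)))//.
  have yx0 : 0 <= x - y by rewrite subr_ge0 ltW.
  rewrite (ger0_norm yx0) mulrC ler_wpM2l//; lra.
Unshelve. all: by end_near. Qed.

Lemma tail_lt e : 0 < e -> exists2 y, 0 <= y & tail y < e.
Proof.
move=> e0.
have := @ge0_nondecreasing_set_cvg_integral _ _ R
  (fun n : nat => `]-oo, n%:R]%classic : set (measurableTypeR R)) (EFin \o f) leb.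
have -> : \bigcup_n [set` `]-oo, n%:R]] = [set: R].
  apply/seteqP; split => z //= _.
  exists (Num.truncn `|z|).+1 => //=; rewrite in_itv/=.
  by rewrite (le_trans (ler_norm z))// ltW// truncnS_gt.
rewrite massE// mass_setT => cv.
have cv1 : (\int[leb]_(x in `]-oo, n%:R]) (f x)%:E)%E @[n --> \oo] --> 1%:E.
  apply: cv => //.
  - move=> n k nk; rewrite subsetEset => z /=; rewrite !in_itv/= => /le_trans; apply.
    by rewrite ler_nat.
  - by move=> n; exact: mfE.
  - by move=> n z _; exact: f0E.
have cv' := fine_cvg cv1.
have : \forall n \near \oo, 1 - e < mass `]-oo, n%:R].
  by apply: (@cvgr_gt R nat \oo _ (fun n : nat => mass `]-oo, n%:R]) 1 (cv' _)); rewrite gtrBl.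
case=> n _ nP.
exists n%:R => //.
by have := nP n (leqnn n); rewrite /= mass_Ny; lra.
Qed.

(** The intermediate value theorem on the right half line reaches the levels up to 1/2, reflection
    the others. The sign clause keeps small levels where the one-sided estimates hold. *)
Lemma tail_surj s : 0 < s -> s < 1 -> exists2 x, (s <= 2^-1 -> 0 <= x) & tail x = s.
Proof.
move=> s0 s1.
have key t : 0 < t -> t <= 2^-1 -> exists2 x, 0 <= x & tail x = t.
  move=> t0 t1; have [y y0 yt] := tail_lt _ t0.
  have [] := @IVT R tail 0 y t y0.
  - by apply: continuous_subspaceT; exact: continuous_tail.
  - by rewrite tail0 ge_min le_max t1 (ltW yt) orbT.
  - by move=> x; rewrite in_itv/= => /andP[x0 _] <-; exists x.
have [s2|s2] := leP s 2^-1; first by have [x x0 xs] := key _ s0 s2; exists x.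
have [||x x0 xs] := key (1 - s); [lra|lra|].
by exists (- x); [lra|rewrite tail_opp xs; lra].
Qed.

(** The monotone hazard rate, free of division. If [tail y > 0], some z > y has f z > 0; by symmetry
    and unimodality f is positive on ]-z, z[, so that x and y are interior to the support. *)
Lemma sumhr_hazard_cross x y : 0 <= x -> x <= y -> f x * tail y <= f y * tail x.
Proof.
move=> x0 xy.
have [ty0|ty] := eqVneq (tail y) 0.
  by rewrite ty0 mulr0 mulr_ge0 ?sumhr_ge0 ?tail_ge0.
have typ : 0 < tail y by rewrite lt_neqAle eq_sym ty tail_ge0.
have txp : 0 < tail x by rewrite (lt_le_trans typ)// tail_nincr.
have [z yz fz] : exists2 z, y < z & 0 < f z.
  have [w w0 wt] := tail_lt _ typ.
  have yw : y < w by rewrite ltNge; apply/negP => /tail_nincr; rewrite leNgt wt.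
  apply: contrapT => H.
  have fz0 z : y < z -> f z <= 0.
    by move=> yz; rewrite leNgt; apply/negP => fz; apply: H; exists z.
  have : mass `]y, w] <= 0 * (w - y).
    by apply: mass_itv_le => [|z /andP[/fz0]//]; exact: ltW.
  by rewrite mul0r -(tail_sub _ _ (ltW yw)) subr_le0 leNgt wt.
have int_supp t : 0 <= t -> t < z -> interior [set u | 0 < f u] t.
  move=> t0 tz; apply/nbhs_ballP; exists (z - t) => /=; first by rewrite subr_gt0.
  move=> u; rewrite /ball/= => ut /=; rewrite (lt_le_trans fz)// sumhr_le//.
  rewrite [leRHS]ger0_norm; last by lra.
  by move: ut; rewrite ltr_distlC ler_norml => /andP[h1 h2]; apply/andP; lra.
have hE t : hazard f t = f t / tail t.
  by rewrite /hazard (_ : density_cdf f t = mass `]-oo, t])// mass_Ny subKr.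
case: hf => _ _ _ /(_ x y); rewrite !hE => h.
have := h (int_supp x x0 (le_lt_trans xy yz)) (int_supp y (le_trans x0 xy) yz) xy.
by rewrite ler_pdivrMr// mulrAC ler_pdivlMr.
Qed.

End Tail.

(** * Hellinger distance between translates *)

Section Hellinger.
Context {R : realType}.
Variables (f : R -> R) (hf : SUMHR f).
Local Notation leb := (@lebesgue_measure R).
Local Notation S := (tail f).

Lemma tail_lt_anti x y : S x < S y -> y < x.
Proof. by move=> h; rewrite ltNge; apply/negP => /(tail_nincr f hf); rewrite leNgt h. Qed.

(** If f vanished at x it would vanish beyond x, and the tail would stay at [S x > 0] although it
    tends to 0. *)
Lemma sumhr_gt0 x : 0 <= x -> 0 < S x -> 0 < f x.
Proof.
move=> x0 Sx; rewrite lt_neqAle eq_sym (sumhr_ge0 f hf) andbT; apply/eqP => fx.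
have [y y0 yt] := tail_lt f hf _ Sx.
have yx := ltW (tail_lt_anti _ _ yt).
have := tail_sub_le f hf _ _ x0 yx; rewrite fx mul0r subr_le0.
by rewrite leNgt yt.
Qed.

Lemma mass_abs_gt c : 0 <= c -> mass f [set x | c < `|x|] = 2 * S c.
Proof.
move=> c0; have -> : [set x | c < `|x|] = `]-oo, (- c)[ `|` `]c, +oo[.
  apply/seteqP; split => x /=; rewrite !in_itv/= andbT.
    by rewrite ltr_normr => /orP[|]; [right|left; rewrite ltrNr].
  by rewrite ltr_normr; case=> h; apply/orP; [right; rewrite ltrNr|left].
rewrite massU//; last first.
  apply/disj_set2P/seteqP; split => z //=; rewrite !in_itv/= andbT => -[h1 h2]; lra.
rewrite -/(tail f c) (_ : mass f `]-oo, (- c)[ = mass f `]-oo, (- c)]).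
  rewrite mass_Ny// tail_opp//; ring.
rewrite /mass integral_itv_bndo_bndc//.
by apply/measurable_EFinP; apply: measurable_funTS; exact: sumhr_measurable.
Qed.

Lemma mass_le1 A : measurable A -> mass f A <= 1.
Proof.
move=> mA; rewrite -(mass_setT f hf) -(setUv A) massU//; [|exact: measurableC|].
  by rewrite lerDl mass_ge0.
exact/disj_setPCl.
Qed.

Lemma integral_mass (A : set R) : measurable A ->
  (\int[leb]_x (f x * \1_A x)%:E = (mass f A)%:E)%E.
Proof.
move=> mA; rewrite -massE// [RHS]integral_mkcond; apply: eq_integral => x _.
rewrite patchE indicE; case: ifPn => xA; first by rewrite mulr1.
by rewrite mulr0.
Qed.

Variables (J : nat) (x : nat -> R) (p r : R).
Hypothesis p0 : 0 < p.
Hypothesis r0 : 0 <= r.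
Hypothesis x_ge0 : forall j, (j <= J.+1)%N -> 0 <= x j.
Hypothesis Sx : forall j, (j <= J.+1)%N -> S (x j) = 2 ^+ j * p.
Hypothesis pJ : 4^-1 <= 2 ^+ J.+1 * p.

Let sgt0 j : 0 < 2 ^+ j * p. Proof. by rewrite mulr_gt0// exprn_gt0. Qed.

Lemma level_decr j : (j <= J)%N -> x j.+1 < x j.
Proof.
move=> jJ; apply: tail_lt_anti; rewrite !Sx ?exprS -?mulrA//; last exact: leqW.
by have := sgt0 j; lra.
Qed.

(** The shell between the two points has mass 2^j p, at least f (x j) times its width, and the
    hazard rate gives f (x j.+1) <= 2 f (x j). *)
Lemma level_density_le j : (j <= J)%N -> f (x j.+1) * (x j - x j.+1) <= 2 ^+ j.+1 * p.
Proof.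
move=> jJ; have lt := level_decr _ jJ; have j1 : (j <= J.+1)%N by exact: leqW.
have h1 : f (x j) * (x j - x j.+1) <= 2 ^+ j * p.
  have := tail_sub_ge f hf (x j.+1) (x j) (x j) (ltW lt).
  rewrite !ger0_norm ?x_ge0// !Sx// => /(_ (ltW lt) (lexx _)) /le_trans; apply.
  by rewrite exprS -mulrA; have := sgt0 j; lra.
have h2 : f (x j.+1) <= 2 * f (x j).
  have := sumhr_hazard_cross f hf (x j.+1) (x j) (x_ge0 _ _) (ltW lt).
  rewrite !Sx// exprS -mulrA; move: (2 ^+ j * p) (sgt0 j) => q q0 h.
  by rewrite -(ler_pM2r q0); have := h jJ; lra.
have d0 : 0 <= x j - x j.+1 by rewrite subr_ge0 ltW.
rewrite (le_trans (ler_wpM2r d0 h2))// exprS -!mulrA; lra.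
Qed.

(** [coef j] bounds the relative variation of the root density over a distance 2 r from a point of
    the j-th shell, and [T_ j] contains that shell (the innermost one, j = J, reaches down to 0).
    [Psi] majorises the squared variation, taking the whole density beyond [x 1]. *)
Let coef j : R := 2 * r / (x j - x j.+1).
Let T_ j : set R := if (j < J)%N then [set y | x j.+2 < `|y|] else setT.
Let Psi (y : R) : R := f y * \1_[set y | x 1 < `|y|] y +
  \sum_(j < J.+1) coef j ^+ 2 * (f y * \1_(T_ j) y).

Let mabs c : measurable [set y : R | c < `|y|].
Proof.
rewrite (_ : [set y | _] = ~` [set y | c >= `|y|]); last first.
  by apply/seteqP; split => y /=; rewrite ltNge => /negP.
apply: measurableC; rewrite (_ : [set y | _] = [set` `[- c, c]]).
  exact: measurable_itv.
by apply/seteqP; split => y /=; rewrite in_itv/= ler_norml.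
Qed.

Let mT j : measurable (T_ j).
Proof. by rewrite /T_; case: ifP. Qed.

Let mf : measurable_fun setT f. Proof. exact: sumhr_measurable. Qed.

Let mPsi : measurable_fun setT Psi.
Proof.
apply: measurable_funD; first by apply: measurable_funM => //; exact: measurable_indic.
apply: measurable_sum => j; apply: measurable_funM => //.
by apply: measurable_funM => //; exact: measurable_indic.
Qed.

Let term_ge0 j y : 0 <= coef j ^+ 2 * (f y * \1_(T_ j) y).
Proof.
apply: mulr_ge0; first exact: sqr_ge0.
by apply: mulr_ge0; [exact: sumhr_ge0|rewrite indicE].
Qed.

Let Psi_ge0 y : 0 <= Psi y.
Proof.
rewrite addr_ge0 ?mulr_ge0 ?(sumhr_ge0 f hf)// ?indicE//.
by apply: sumr_ge0 => j _; exact: term_ge0.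
Qed.

Let Psi_norm y : Psi `|y| = Psi y.
Proof.
have iN (A : set R) : (forall u, A `|u| = A u) -> \1_A `|y| = \1_A y :> R.
  by move=> AE; rewrite !indicE; congr (nat_of_bool _)%:R; apply/idP/idP; rewrite !inE AE.
rewrite /Psi sumhr_norm// iN; last by move=> u; rewrite /= normr_id.
congr (_ + _); apply: eq_bigr => j _; rewrite iN// => u.
by rewrite /T_; case: ifP => //=; rewrite normr_id.
Qed.

Let measurable_sqrt_translate a : measurable_fun setT (fun y => Num.sqrt (translate f a y)).
Proof.
have msq : measurable_fun setT (@Num.sqrt R).
  by apply: continuous_measurable_fun; exact: sqrt_continuous.
apply: (measurableT_comp msq); apply: (measurableT_comp mf).
exact: measurable_funB.
Qed.

(** With rho = S z / S y, the hazard rate gives f z >= rho * f y, hence sqrt (f z) >= rho * sqrt (f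
    y) as rho <= 1. It remains to bound 1 - rho, the relative loss of tail mass, by [coef j]. *)
Let key y z : 0 <= y -> y <= z -> z <= y + 2 * r ->
  (Num.sqrt (f y) - Num.sqrt (f z)) ^+ 2 <= Psi y.
Proof.
move=> y0 yz zr.
have fy0 := sumhr_ge0 f hf y; have fz0 := sumhr_ge0 f hf z.
have fzy : f z <= f y.
  by rewrite sumhr_le// !ger0_norm// (le_trans y0).
have sq : Num.sqrt (f z) <= Num.sqrt (f y) by rewrite ler_wsqrtr.
have sz0 := sqrtr_ge0 (f z).
have sfy : Num.sqrt (f y) ^+ 2 = f y by rewrite sqr_sqrtr.
have rest0 : 0 <= \sum_(j < J.+1) coef j ^+ 2 * (f y * \1_(T_ j) y).
  by apply: sumr_ge0 => j _; exact: term_ge0.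
rewrite /Psi; have [yx1|yx1] := ltP (x 1) y.
  rewrite indicE mem_set/= ?ger0_norm// mulr1 ler_wpDr//.
  rewrite -[leRHS]sfy lerXn2r// ?nnegrE ?subr_ge0 ?sqrtr_ge0//; lra.
(* The shell of y is found as the largest admissible j. *)
have [j jJ [yj jP]] : exists2 j, (j <= J)%N & y <= x j.+1 /\ ((j < J)%N -> x j.+2 < y).
  have exP : exists j, (j <= J)%N && (y <= x j.+1) by exists 0%N.
  have ub j : (j <= J)%N && (y <= x j.+1) -> (j <= J)%N by case/andP.
  case: (ex_maxnP exP ub) => j /andP[jJ yj] jmax; exists j => //; split => // jJ'.
  rewrite ltNge; apply/negP => h; have := jmax j.+1; rewrite jJ' h ltnn.
  by move=> /(_ isT).
have Syp : 0 < S y.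
  by rewrite (lt_le_trans (sgt0 j.+1))// -Sx// tail_nincr.
have yTj : \1_(T_ j) y = 1 :> R.
  rewrite indicE /T_; case: ifPn => [/jP xy|_]; rewrite mem_set//=.
  by rewrite ger0_norm.
apply: (@le_trans _ _ (coef j ^+ 2 * f y)); last first.
  rewrite (bigD1 (Ordinal (jJ : (j < J.+1)%N)))//= yTj mulr1 addrCA lerDl addr_ge0//.
    by rewrite mulr_ge0// ?indicE//.
  by apply: sumr_ge0 => i _; exact: term_ge0.
have L0 : 0 < x j - x j.+1 by rewrite subr_gt0 level_decr.
have c0 : 0 <= coef j by apply: divr_ge0; [rewrite mulr_ge0|exact: ltW].
pose rho := S z / S y.
have rho0 : 0 <= rho by rewrite divr_ge0// ?tail_ge0.
have rho1 : rho <= 1 by rewrite ler_pdivrMr// mul1r tail_nincr.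
have frho : f y * rho <= f z.
  rewrite mulrA ler_pdivrMr//; exact: sumhr_hazard_cross.
have hz : 1 - rho <= coef j.
  (* The hazard rate at y is at most the one at [x j.+1], itself at most the inverse width of the
     next shell outwards. *)
  have fxj : f y / S y <= (x j - x j.+1)^-1.
    have s1 := sgt0 j.+1.
    apply: (@le_trans _ _ (f (x j.+1) / (2 ^+ j.+1 * p))).
      rewrite ler_pdivrMr// mulrAC ler_pdivlMr// -Sx//.
      by apply: sumhr_hazard_cross.
    rewrite ler_pdivrMr// -(ler_pM2r L0) mulrAC mulVf ?gt_eqF// mul1r.
    by apply: level_density_le.
  have -> : 1 - rho = (S y - S z) / S y by rewrite mulrBl divff ?gt_eqF.
  apply: (@le_trans _ _ (f y * (2 * r) / S y)).
    rewrite ler_pM2r ?invr_gt0// (le_trans (tail_sub_le f hf _ _ y0 yz))//.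
    by rewrite ler_wpM2l//; lra.
  rewrite (mulrC (f y)) -mulrA /coef ler_wpM2l// mulr_ge0//.
have sz : Num.sqrt (f y) * rho <= Num.sqrt (f z).
  rewrite -(ger0_norm rho0) -sqrtr_sqr -sqrtrM// ler_wsqrtr// (le_trans _ frho)//.
  by rewrite ler_wpM2l// expr2 ler_piMr.
have lhs0 : 0 <= Num.sqrt (f y) - Num.sqrt (f z) by rewrite subr_ge0.
have rhs0 : 0 <= coef j * Num.sqrt (f y) by rewrite mulr_ge0// sqrtr_ge0.
rewrite -[X in _ <= _ * X]sfy -exprMn lerXn2r//.
apply: (@le_trans _ _ (Num.sqrt (f y) * (1 - rho))).
  by rewrite mulrBr mulr1 lerB.
by rewrite mulrC ler_wpM2r ?sqrtr_ge0.
Qed.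

(** The mass beyond [x 1] is 4 p. Each [T_ j] has mass at most 8 * 2^j p: twice the tail at level j
    + 2 if j < J, and 1 <= 4 * 2^(J+1) p if j = J. *)
Let intPsi : (\int[leb]_y (Psi y)%:E <=
  (4 * p + 32 * p * r ^+ 2 * \sum_(j < J.+1) 2 ^+ j / (x j - x j.+1) ^+ 2)%:E)%E.
Proof.
under eq_integral do rewrite EFinD -sumEFin.
have mi (A : set R) : measurable A -> measurable_fun setT (fun y => (f y * \1_A y)%:E).
  move=> mA; apply/measurable_EFinP; apply: measurable_funM => //; exact: measurable_indic.
have i0 (A : set R) y : (0 <= (f y * \1_A y)%:E)%E.
  by rewrite lee_fin mulr_ge0 ?(sumhr_ge0 f hf)// ?indicE//.
have m2 j : measurable_fun setT (fun y => (coef j ^+ 2 * (f y * \1_(T_ j) y))%:E).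
  by under eq_fun do rewrite EFinM; apply: measurable_funeM; exact: mi.
have j0 j y : (0 <= (coef j ^+ 2 * (f y * \1_(T_ j) y))%:E)%E.
  by rewrite EFinM mule_ge0// lee_fin sqr_ge0.
rewrite ge0_integralD//; [|exact: mi|by move=> y _; apply: sume_ge0|apply: emeasurable_sum => j; exact: m2].
rewrite integral_mass// ge0_integral_sum//; last by move=> j; exact: m2.
have sumE j : (\int[leb]_y (coef j ^+ 2 * (f y * \1_(T_ j) y))%:E = (coef j ^+ 2 * mass f (T_ j))%:E)%E.
  under eq_integral do rewrite EFinM.
  rewrite ge0_integralZl//; [|exact: mi|by rewrite lee_fin sqr_ge0].
  by rewrite integral_mass// -EFinM.
under eq_bigr do rewrite sumE.
rewrite sumEFin -EFinD lee_fin mass_abs_gt ?x_ge0// Sx// expr1; apply: lerD; first lra.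
rewrite mulr_sumr; apply: ler_sum => j _.
have massT : mass f (T_ j) <= 8 * (2 ^+ j * p).
  rewrite /T_; case: ifPn => jJ.
    rewrite mass_abs_gt ?x_ge0// Sx// !exprS; have := sgt0 j; lra.
  have -> : nat_of_ord j = J.
    by apply/eqP; rewrite eqn_leq -ltnS ltn_ord/= leqNgt.
  rewrite (le_trans (mass_le1 _ measurableT))//.
  move: pJ; rewrite exprS -mulrA; lra.
rewrite (le_trans (ler_wpM2l (sqr_ge0 _) massT))// /coef.
have L0 : x j - x j.+1 != 0 by rewrite gt_eqF// subr_gt0 level_decr// -ltnS.
rewrite le_eqVlt; apply/orP; left; apply/eqP; field; exact: L0.
Qed.

(** Whichever of |y| and |y - 2 r| is smaller serves as starting point in [key], so Psi y + Psi (y -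
    2 r) majorises the integrand. The two equal integrals compensate the factor 1/2 of the Hellinger
    distance. *)
Lemma hellinger_shift : (hellinger2 (translate f 0) (translate f (2 * r)) <=
  (4 * p + 32 * p * r ^+ 2 * \sum_(j < J.+1) 2 ^+ j / (x j - x j.+1) ^+ 2)%:E)%E.
Proof.
set K := (4 * p + _).
have shift : (\int[leb]_y (Psi (y - 2 * r))%:E = \int[leb]_y (Psi y)%:E)%E.
  rewrite -(@integral_isometry R 1 (- (2 * r)) (or_introl erefl) setT Psi measurableT mPsi Psi_ge0).
  by rewrite preimage_setT; apply: eq_integral => y _; rewrite mul1r.
have le2 : (\int[leb]_y ((Num.sqrt (translate f 0 y) - Num.sqrt (translate f (2 * r) y)) ^+ 2)%:E
    <= K%:E + K%:E)%E.
  apply: (@le_trans _ _ (\int[leb]_y ((Psi y)%:E + (Psi (y - 2 * r))%:E))%E); last first.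
    rewrite ge0_integralD//.
    - by rewrite shift; apply: leeD; exact: intPsi.
    - by move=> y _; rewrite lee_fin.
    - exact/measurable_EFinP.
    - by move=> y _; rewrite lee_fin.
    - by apply/measurable_EFinP; apply: (measurableT_comp mPsi); apply: measurable_funB.
  apply: ge0_le_integral => //.
  - by move=> y _; rewrite lee_fin sqr_ge0.
  - apply/measurable_EFinP; apply: measurable_funX; apply: measurable_funB.
      by apply: measurable_sqrt_translate.
    by apply: measurable_sqrt_translate.
  - apply: emeasurable_funD; first exact/measurable_EFinP.
    by apply/measurable_EFinP; apply: (measurableT_comp mPsi); apply: measurable_funB.
  - move=> y _; rewrite -EFinD lee_fin /translate subr0.
    have [h|h] := leP `|y| `|y - 2 * r|.
      rewrite ler_wpDr// -(sumhr_norm f hf y) -(sumhr_norm f hf (y - _)) -Psi_norm.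
      apply: key => //; rewrite (le_trans (ler_normB _ _))// (ger0_norm (mulr_ge0 _ r0))//.
    rewrite ler_wpDl// -(sumhr_norm f hf y) -(sumhr_norm f hf (y - _)) -Psi_norm -sqrrN opprB.
    apply: key => //; first exact: ltW.
    by rewrite -{1}(subrK (2 * r) y) (le_trans (ler_normD _ _))// (ger0_norm (mulr_ge0 _ r0)).
rewrite /hellinger2 (le_trans (lee_wpmul2l _ le2))// -EFinD -EFinM lee_fin; lra.
Qed.

End Hellinger.

(** * Quantiles and their linearisation *)

Section GeometricScale.
Context {R : realType}.

(* [ratio = 2 ^ (-1/8)].  At level [j] the relative fluctuation of an order
   statistic is allowed to be [ratio ^ (3 j)] and the error of its linearisation
   [ratio ^ (5 j)]: the exponents lie below 4, resp. above 4 (the standard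
   deviation is [2 ^ (-j/2) = ratio ^ (4 j)]), so that failure probabilities and
   errors are both summable in [j]. *)
Definition ratio : R := Num.sqrt (Num.sqrt (Num.sqrt 2^-1)).

Lemma ratio_gt0 : 0 < ratio.
Proof. by rewrite !sqrtr_gt0 invr_gt0. Qed.

Lemma ratio8 : ratio ^+ 8 = 2^-1.
Proof.
have s (x : R) : 0 <= x -> Num.sqrt x ^+ 2 = x by exact: sqr_sqrtr.
rewrite (_ : 8 = 2 * (2 * 2))%N// !exprM !s ?sqrtr_ge0//; lra.
Qed.

(** The value 12/13 makes the geometric series of [ratio] sum to at most 13; likewise 5/7 below
    gives 7/2 for [ratio ^+ 4]. *)
Lemma ratio_le : ratio <= 12 / 13.
Proof.
have c0 : 0 <= 12 / 13 :> R by lra.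
rewrite -(@ler_pXn2r _ 8)// ?nnegrE ?(ltW ratio_gt0)// ratio8; lra.
Qed.

Lemma ratio_le1 : ratio <= 1. Proof. by have := ratio_le; lra. Qed.

Lemma ratioX_gt0 j : 0 < ratio ^+ j. Proof. by rewrite exprn_gt0 ?ratio_gt0. Qed.

Lemma ratioX_le1 j : ratio ^+ j <= 1.
Proof. by rewrite exprn_ile1 ?ratio_le1// ltW ?ratio_gt0. Qed.

Lemma ratioX_anti i j : (i <= j)%N -> ratio ^+ j <= ratio ^+ i.
Proof. by move=> ij; rewrite ler_wiXn2l// ?ratio_le1// ltW ?ratio_gt0. Qed.

Lemma ratio4_le : ratio ^+ 4 <= 5 / 7.
Proof.
have c0 : 0 <= 5 / 7 :> R by lra.
rewrite -(@ler_pXn2r _ 2)// ?nnegrE ?(ltW (ratioX_gt0 4))// -exprM ratio8; lra.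
Qed.

Lemma two_ratioX j : 2 ^+ j * ratio ^+ (8 * j) = 1 :> R.
Proof. by rewrite exprM ratio8 -exprMn divff// expr1n. Qed.

Lemma geometric_le (q c : R) n : 0 <= q -> q < 1 -> 1 <= c * (1 - q) ->
  \sum_(j < n) q ^+ j <= c.
Proof.
move=> q0 q1 cq; have q1' : 0 < 1 - q by rewrite subr_gt0.
rewrite -(ler_pM2r q1') (le_trans _ cq)//.
have -> : (\sum_(j < n) q ^+ j) * (1 - q) = 1 - q ^+ n.
  rewrite -{2}(expr1n _ n) subrXX mulrC; congr (_ * _).
  by apply: eq_bigr => i _; rewrite expr1n mul1r.
by rewrite gerBl exprn_ge0.
Qed.

End GeometricScale.

(** * The upper quantile function and the Bahadur representation *)

Section Quantile.
Context {R : realType}.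
Variables (f : R -> R) (hf : SUMHR f).
Local Notation S := (tail f).

Definition quantile (s : R) : R :=
  xget 0 [set x | (s <= 2^-1 -> 0 <= x) /\ S x = s].

Lemma quantileP s : 0 < s -> s < 1 -> (s <= 2^-1 -> 0 <= quantile s) /\ S (quantile s) = s.
Proof.
move=> s0 s1; rewrite /quantile; case: xgetP => [x _ //|].
by have [x x0 xs] := tail_surj f hf s s0 s1 => /(_ x)[].
Qed.

Lemma tail_quantile s : 0 < s -> s < 1 -> S (quantile s) = s.
Proof. by move=> s0 s1; have [] := quantileP s s0 s1. Qed.

Lemma quantile_ge0 s : 0 < s -> s <= 2^-1 -> 0 <= quantile s.
Proof. move=> s0 s1; have s1' : s < 1 by lra. by have [->] := quantileP s s0 s1'. Qed.

(** Unimodality puts the increment of the tail between f x and f y times the distance, so the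
    linearisation error has a fixed sign. The hazard rate compares f x with f y and bounds that
    error quadratically. *)
Lemma tail_expansion x y : 0 <= x -> 0 <= y -> 0 < S x -> 0 < S y ->
  `|y - x + (S y - S x) / f x| <= (S y - S x) ^+ 2 / (f x * S y).
Proof.
move=> x0 y0 Sx Sy; have F0 := sumhr_gt0 f hf _ x0 Sx.
have G0 := sumhr_gt0 f hf _ y0 Sy.
have FS : 0 < f x * S y by rewrite mulr_gt0.
rewrite ler_pdivlMr// -[X in _ * X <= _](gtr0_norm FS) -normrM.
have -> : (y - x + (S y - S x) / f x) * (f x * S y) =
    ((y - x) * f x + (S y - S x)) * S y by field; rewrite gt_eqF.
have [xy|yx] := leP x y.
  have h1 := tail_sub_le f hf x y x0 xy.
  have h2 : f y * (y - x) <= S x - S y.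
    by apply: tail_sub_ge => //; rewrite !ger0_norm.
  have h3 := sumhr_hazard_cross f hf x y x0 xy.
  have yx0 : 0 <= y - x by rewrite subr_ge0.
  have h4 := ler_wpM2r yx0 h3.
  have h5 := ler_wpM2r (ltW Sx) h2.
  rewrite ger0_norm; first nra.
  by apply: mulr_ge0; [lra|exact: ltW].
have yx' := ltW yx.
have h1 := tail_sub_le f hf y x y0 yx'.
have h2 : f x * (x - y) <= S y - S x.
  by apply: tail_sub_ge => //; rewrite !ger0_norm.
have h3 := sumhr_hazard_cross f hf y x y0 yx'.
have yx0 : 0 <= x - y by rewrite subr_ge0.
have h4 := ler_wpM2r yx0 h3.
have h5 := ler_wpM2r (ltW Sx) h1.
rewrite ger0_norm; first nra.
by apply: mulr_ge0; [lra|exact: ltW].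
Qed.

Lemma quantile_expansion s e : 0 < s -> s <= 2^-1 -> -1 < e -> s * (1 + e) <= 2^-1 ->
  `|quantile (s * (1 + e)) - quantile s + s / f (quantile s) * e| <=
  s / f (quantile s) * (e ^+ 2 / (1 + e)).
Proof.
move=> s0 s2 e1 se2; have e1' : 0 < 1 + e by lra.
have se0 : 0 < s * (1 + e) by rewrite mulr_gt0.
have Ss : S (quantile s) = s by rewrite tail_quantile//; lra.
have Sse : S (quantile (s * (1 + e))) = s * (1 + e) by rewrite tail_quantile//; lra.
have q0 := quantile_ge0 _ s0 s2; have qe0 := quantile_ge0 _ se0 se2.
have F0 : 0 < f (quantile s) by rewrite sumhr_gt0// Ss.
have := tail_expansion _ _ q0 qe0; rewrite Ss Sse => /(_ s0 se0).
congr (`|_ + _| <= _); first by field; rewrite gt_eqF.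
by field; rewrite !gt_eqF.
Qed.

(** Deterministic Bahadur representation: [N a] is the count beyond the quantile of level [a], and
    [Y] the order statistic of rank (m + 1) s. If the counts are nearly linear on a grid around s,
    [Y] is trapped between two neighbouring quantiles, which are then expanded. *)
Lemma bahadur (N : R -> R) (Y m s t eps W : R) :
  0 < s -> 0 < m -> 0 < eps -> t + m^-1 + 2 * eps <= W -> W < 1 ->
  s * (1 + W) <= 2^-1 ->
  (forall a, 0 < a -> a <= 2^-1 -> (m + 1) * s <= N a -> quantile a <= Y) ->
  (forall a, 0 < a -> a <= 2^-1 -> N a < (m + 1) * s -> Y <= quantile a) ->
  `|N s - m * s| <= m * s * t ->
  (forall z : int, `|z%:~R * eps| <= W ->
    `|N (s * (1 + z%:~R * eps)) - N s - m * s * (z%:~R * eps)| < m * s * eps) ->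
  `|Y - quantile s - s / f (quantile s) * ((N s - (m + 1) * s) / (m * s))| <=
  s / f (quantile s) * (2 * eps + W ^+ 2 / (1 - W)).
Proof.
move=> s0 m0 eps0 tW W1 sW YN NY E1 E2.
have ms0 : 0 < m * s by rewrite mulr_gt0.
have t0 : 0 <= t by rewrite -(pmulr_rge0 _ ms0) (le_trans _ E1).
have mi0 : 0 < m^-1 by rewrite invr_gt0.
have W0 : 0 < W by lra.
have s2 : s <= 2^-1.
  by rewrite (le_trans _ sW)// ler_peMr ?(ltW s0)//; lra.
(* Relative shift of the level at which the linearised count reaches the rank. *)
pose D := ((m + 1) * s - N s) / (m * s).
have DE : N s + m * s * D = (m + 1) * s by rewrite /D; field; rewrite !gt_eqF.
have Db : `|D| <= t + m^-1.
  rewrite normrM (gtr0_norm (x := (m * s)^-1)) ?invr_gt0// ler_pdivrMr//.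
  have -> : (t + m^-1) * (m * s) = m * s * t + s by field; rewrite gt_eqF.
  have -> : (m + 1) * s - N s = - (N s - m * s) + s by ring.
  by rewrite (le_trans (ler_normD _ _))// normrN (gtr0_norm s0) lerD2r.
move: (Db); rewrite ler_norml => /andP[D1 D2].
have F0 : 0 < f (quantile s).
  by rewrite sumhr_gt0// ?quantile_ge0// tail_quantile//; lra.
pose g := s / f (quantile s).
have g0 : 0 < g by rewrite divr_gt0.
have ex z : `|z%:~R * eps| <= W ->
    `|quantile (s * (1 + z%:~R * eps)) - quantile s + g * (z%:~R * eps)|
    <= g * (W ^+ 2 / (1 - W)).
  move=> zW; move: (zW); rewrite ler_norml => /andP[z1 z2].
  have e1 : -1 < z%:~R * eps by lra.
  have e2 : s * (1 + z%:~R * eps) <= 2^-1.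
    by rewrite (le_trans _ sW)// ler_pM2l//; lra.
  rewrite (le_trans (quantile_expansion _ _ s0 s2 e1 e2))// ler_pM2l//.
  rewrite ler_pM ?invr_ge0 ?sqr_ge0//; first by lra.
    by rewrite -real_normK ?num_real// lerXn2r// nnegrE// ltW.
  by rewrite lef_pV2 ?posrE; lra.
have dom z : `|z%:~R * eps| <= W -> 0 < s * (1 + z%:~R * eps) /\ s * (1 + z%:~R * eps) <= 2^-1.
  rewrite ler_norml => /andP[z1 z2]; split; first by rewrite mulr_gt0//; lra.
  by rewrite (le_trans _ sW)// ler_pM2l//; lra.
(* The extra grid step leaves a margin [eps] on either side of D, enough for the grid error in [E2];
   both points stay within 2 eps of D, hence inside the window W. *)
pose z1 : int := Num.ceil (D / eps) + 1.
pose z2 : int := Num.floor (D / eps) - 1.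
have [z1l z1u] : D + eps <= z1%:~R * eps /\ z1%:~R * eps <= D + 2 * eps.
  have /andP[h1 h2] := ceil_itv (D / eps); rewrite /z1.
  move: h1 h2; rewrite ler_pdivrMr// ltr_pdivlMr// rmorphB rmorphD/= => h1 h2.
  by split; lra.
have [z2l z2u] : D - 2 * eps <= z2%:~R * eps /\ z2%:~R * eps <= D - eps.
  have /andP[h1 h2] := floor_itv (D / eps); rewrite /z2.
  move: h1 h2; rewrite ler_pdivlMr// ltr_pdivrMr// rmorphB rmorphD/= => h1 h2.
  by split; lra.
have z1W : `|z1%:~R * eps| <= W by rewrite ler_norml; apply/andP; split; lra.
have z2W : `|z2%:~R * eps| <= W by rewrite ler_norml; apply/andP; split; lra.
have lo : quantile (s * (1 + z1%:~R * eps)) <= Y.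
  have [d0 d1] := dom _ z1W; apply: YN => //; rewrite -DE.
  have := E2 _ z1W; rewrite ltr_norml => /andP[h _].
  have := ler_wpM2l (ltW ms0) z1l; lra.
have hi : Y <= quantile (s * (1 + z2%:~R * eps)).
  have [d0 d1] := dom _ z2W; apply: NY => //; rewrite -DE.
  have := E2 _ z2W; rewrite ltr_norml => /andP[_ h].
  have := ler_wpM2l (ltW ms0) z2u; lra.
have -> : (N s - (m + 1) * s) / (m * s) = - D by rewrite /D; field; rewrite !gt_eqF.
rewrite mulrN opprK -/g.
have := ex _ z1W; rewrite ler_norml => /andP[h1 _].
have := ex _ z2W; rewrite ler_norml => /andP[_ h2].
have h3 := ler_wpM2l (ltW g0) z1u; have h4 := ler_wpM2l (ltW g0) z2l.
rewrite ler_norml; apply/andP; split; lra.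
Qed.

End Quantile.

(** * Random weights against deterministic ones *)

Section Weights.
Context {R : realType}.
Variables (J : nat) (g : nat -> R).
Hypothesis g0 : forall j, (j <= J)%N -> 0 < g j.
Local Notation u := (@ratio R).

(* [info ^ 2] plays the role of the Fisher information: [info^-1] is the accuracy
   to be reached, and also the order of the local modulus at [p]. *)
Definition info : R := Num.sqrt (\sum_(j < J.+1) 2 ^+ j / g j ^+ 2).
(** This is 2^(j/2) / g j, the square root of the j-th summand of [info ^+ 2]. *)
Definition amplitude (j : nat) : R := 2 ^+ j * u ^+ (4 * j) / g j.

Lemma amp_gt0 j : (j <= J)%N -> 0 < amplitude j.
Proof. by move=> jJ; rewrite divr_gt0 ?g0// mulr_gt0 ?exprn_gt0 ?ratio_gt0. Qed.

Lemma amp_sqr j : amplitude j ^+ 2 = 2 ^+ j / g j ^+ 2.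
Proof.
rewrite /amplitude exprMn exprVn exprMn; congr (_ / _).
by rewrite -(exprM u) mulnC mulnA expr2 -mulrA two_ratioX mulr1.
Qed.

Lemma info_sqr : info ^+ 2 = \sum_(j < J.+1) amplitude j ^+ 2.
Proof.
rewrite sqr_sqrtr; first by apply: eq_bigr => j _; rewrite amp_sqr.
by apply: sumr_ge0 => j _; rewrite -amp_sqr sqr_ge0.
Qed.

Lemma info_gt0 : 0 < info.
Proof.
rewrite sqrtr_gt0 big_ord_recl/=; apply: ltr_pwDl.
  by rewrite -amp_sqr exprn_gt0// amp_gt0.
by apply: sumr_ge0 => j _; rewrite -amp_sqr sqr_ge0.
Qed.

Lemma amp_le_info j : (j <= J)%N -> amplitude j <= info.
Proof.
move=> jJ; rewrite -(@ler_pXn2r _ 2)// ?nnegrE ?(ltW info_gt0) ?(ltW (amp_gt0 _ jJ))//.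
rewrite info_sqr (bigD1 (Ordinal (jJ : (j < J.+1)%N)))//= lerDl.
by apply: sumr_ge0 => i _; rewrite sqr_ge0.
Qed.

Lemma sum_ratio_amp_le : \sum_(j < J.+1) u ^+ j * amplitude j <= 13 * info.
Proof.
apply: (@le_trans _ _ (\sum_(j < J.+1) u ^+ j * info)).
  by apply: ler_sum => j _; rewrite ler_pM2l ?ratioX_gt0// amp_le_info// -ltnS.
have h1 := @ratio_le R; have h2 := @ratio_gt0 R.
by rewrite -mulr_suml ler_pM2r ?info_gt0// geometric_le//; lra.
Qed.

Lemma sum_ratio4_amp_le : \sum_(j < J.+1) u ^+ (4 * j) * amplitude j <= 7 / 2 * info.
Proof.
apply: (@le_trans _ _ (\sum_(j < J.+1) (u ^+ 4) ^+ j * info)).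
  apply: ler_sum => j _; rewrite -exprM ler_pM2l ?ratioX_gt0// amp_le_info// -ltnS//.
have h1 := @ratio4_le R; have h2 := @ratioX_gt0 R 4.
by rewrite -mulr_suml ler_pM2r ?info_gt0// geometric_le//; lra.
Qed.

Lemma row_sum_le (q c : R) (j n : nat) : 0 <= q -> q <= 1 -> 1 <= c * (1 - q) -> 0 <= c ->
  \sum_(i < n) q ^+ (maxn i j - minn i j) <= 2 * c.
Proof.
move=> q0 q1 cq c0.
have qX k : 0 <= q ^+ k by rewrite exprn_ge0.
(* The powers of q on the right of [lo] and [hi] account for the terms not yet summed and carry the
   induction on n. *)
have lo : \sum_(i < n) (if (i <= j)%N then q ^+ (j - i) else 0) <= c * q ^+ (j.+1 - n).
  elim: n => [|n IH]; first by rewrite big_ord0 mulr_ge0.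
  rewrite big_ord_recr/=; case: leqP => [nj|nj].
    rewrite subSS; apply: (le_trans (lerD IH (lexx _))).
    by rewrite subSn// exprS; have := ler_wpM2l (qX (j - n)%N) cq; lra.
  rewrite addr0 (le_trans IH)//.
  have /eqP -> : (j.+1 - n == 0)%N by rewrite subn_eq0.
  by have /eqP -> : (j.+1 - n.+1 == 0)%N by rewrite subn_eq0 ltnW.
have hi : \sum_(i < n) (if (i <= j)%N then 0 else q ^+ (i - j)) <= c * (1 - q ^+ (n - j)).
  elim: n {lo} => [|n IH]; first by rewrite big_ord0 sub0n expr0 subrr mulr0.
  rewrite big_ord_recr/=; case: leqP => [nj|nj].
    rewrite addr0 (le_trans IH)// ler_wpM2l// lerD2l lerN2.
    have /eqP -> : (n - j == 0)%N by rewrite subn_eq0.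
    by rewrite expr0 exprn_ile1.
  apply: (le_trans (lerD IH (lexx _))).
  by rewrite subSn ?(ltnW nj)// exprS; have := ler_wpM2l (qX (n - j)%N) cq; lra.
have -> : \sum_(i < n) q ^+ (maxn i j - minn i j) =
    \sum_(i < n) (if (i <= j)%N then q ^+ (j - i) else 0) +
    \sum_(i < n) (if (i <= j)%N then 0 else q ^+ (i - j)).
  rewrite -big_split/=; apply: eq_bigr => i _.
  by case: leqP => ij; rewrite ?addr0 ?add0r.
have h1 : q ^+ (j.+1 - n) <= 1 by rewrite exprn_ile1.
have h2 := ler_wpM2l c0 h1; have h3 := mulr_ge0 c0 (qX (n - j)%N).
lra.
Qed.

(** Schur test: ab <= (a^2 + b^2) / 2, and every row of the symmetric kernel sums to at most 7. *)
Lemma schur_le : \sum_(i < J.+1) \sum_(j < J.+1)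
   amplitude i * amplitude j * (u ^+ 4) ^+ (maxn i j - minn i j) <= 7 * info ^+ 2.
Proof.
set K := fun i j : nat => (u ^+ 4) ^+ (maxn i j - minn i j).
have K0 i j : 0 <= K i j by rewrite exprn_ge0// ltW// ratioX_gt0.
have row j : \sum_(i < J.+1) K i j <= 7.
  have h1 := @ratio4_le R; have h2 := @ratioX_gt0 R 4.
  rewrite (_ : 7 = 2 * (7 / 2)); last lra.
  by apply: row_sum_le; lra.
have KC i j : K i j = K j i by rewrite /K maxnC minnC.
apply: (@le_trans _ _ (\sum_(i < J.+1) \sum_(j < J.+1)
    (amplitude i ^+ 2 / 2 * K i j + amplitude j ^+ 2 / 2 * K i j))).
  apply: ler_sum => i _; apply: ler_sum => j _.
  rewrite -mulrDl; apply: ler_wpM2r; first exact: K0.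
  by have := sqr_ge0 (amplitude i - amplitude j); move: (amplitude i) (amplitude j) => a b; nra.
under eq_bigr do rewrite big_split/=.
rewrite big_split/= [X in _ + X]exchange_big/=.
have half : \sum_(i < J.+1) \sum_(j < J.+1) amplitude i ^+ 2 / 2 * K i j <= 7 / 2 * info ^+ 2.
  rewrite info_sqr mulr_sumr; apply: ler_sum => i _.
  rewrite -mulr_sumr; under eq_bigr do rewrite KC.
  have := ler_wpM2l (sqr_ge0 (amplitude i)) (row i); lra.
have half' : \sum_(j < J.+1) \sum_(i < J.+1) amplitude j ^+ 2 / 2 * K i j <= 7 / 2 * info ^+ 2.
  by under eq_bigr do under eq_bigr do rewrite KC.
lra.
Qed.

(** [L] is the deterministic spacing and [l] its hold-out estimate; [M] is the error of the
    mid-summary and [B] the normalised difference of the counts in the two tails. *)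
Variables (L l M B : nat -> R).
Hypothesis L_lo : forall j, (j <= J)%N -> g j / 2 <= L j.
Hypothesis L_hi : forall j, (j <= J)%N -> L j <= g j.
Hypothesis l_lo : forall j, (j <= J)%N -> g j / 8 <= l j.
Hypothesis lL : forall j, (j <= J)%N -> `|l j - L j| <= u ^+ (3 * j) * g j.
Hypothesis MB : forall j, (j <= J)%N -> `|M j - g j / 2 * B j| <= 4 * g j * u ^+ (5 * j).
Hypothesis B_le : forall j, (j <= J)%N -> `|B j| <= u ^+ (3 * j).
Hypothesis main_le :
  `|\sum_(j < J.+1) 2 ^+ j / L j ^+ 2 * (g j / 2 * B j)| <= 28 * info.

Let w j : R := 2 ^+ j / l j ^+ 2.
Let v j : R := 2 ^+ j / L j ^+ 2.

Let l_hi j : (j <= J)%N -> l j <= 2 * g j.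
Proof.
move=> jJ; have := lL _ jJ; have := L_hi _ jJ; have gj := g0 _ jJ.
rewrite ler_norml => h1 /andP[_ h2].
have := ler_wpM2r (ltW gj) (@ratioX_le1 R (3 * j)).
by move: h2; move: (u ^+ _) => ? ? ?; lra.
Qed.

Lemma sum_weight_ge : info ^+ 2 / 4 <= \sum_(j < J.+1) w j.
Proof.
rewrite info_sqr mulr_suml; apply: ler_sum => j _; rewrite amp_sqr /w.
have jJ : (j <= J)%N by rewrite -ltnS.
have gj := g0 _ jJ; have lj : 0 < l j by have := l_lo _ jJ; lra.
have e2 : 0 < 2 ^+ j :> R by rewrite exprn_gt0.
rewrite -mulrA -invfM (ler_pM2l e2) lef_pV2 ?posrE ?exprn_gt0//; last first.
  by rewrite mulr_gt0// exprn_gt0.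
have := l_hi _ jJ => h.
have : l j ^+ 2 <= (2 * g j) ^+ 2 by rewrite lerXn2r// ?nnegrE; lra.
lra.
Qed.

Let v_le j : (j <= J)%N -> v j <= 4 * 2 ^+ j / g j ^+ 2.
Proof.
move=> jJ; have gj := g0 _ jJ; have Lj := L_lo _ jJ.
rewrite /v (mulrC 4) -mulrA ler_pM2l ?exprn_gt0//.
rewrite ler_pdivlMr ?exprn_gt0// mulrC ler_pdivrMr ?exprn_gt0//; last by lra.
have : (g j / 2) ^+ 2 <= L j ^+ 2 by rewrite lerXn2r// ?nnegrE; lra.
lra.
Qed.

(** In the difference of the inverse squares, |l - L| carries the small factor and l + L <= 3 g; the
    lower bounds g/8 and g/2 give 768 = 3 * 8^2 * 2^2. *)
Let wv_le j : (j <= J)%N -> `|w j - v j| <= 768 * u ^+ (3 * j) * (2 ^+ j / g j ^+ 2).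
Proof.
move=> jJ; have gj := g0 _ jJ; have Lj := L_lo _ jJ; have lj := l_lo _ jJ.
have Lh := L_hi _ jJ; have lh := l_hi _ jJ.
move: (lL _ jJ) (@ratioX_gt0 R (3 * j)); move: (u ^+ (3 * j)) => e lLj e0.
have lp : 0 < l j by lra.
have Lp : 0 < L j by lra.
have -> : w j - v j = 2 ^+ j * ((L j - l j) * (L j + l j) / (l j ^+ 2 * L j ^+ 2)).
  by rewrite /w /v; field; rewrite !gt_eqF.
have e2 : 0 < 2 ^+ j :> R by rewrite exprn_gt0.
rewrite normrM (gtr0_norm e2) (mulrCA _ (2 ^+ j) (g j ^- 2)) (ler_pM2l e2).
rewrite normrM (gtr0_norm (x := _^-1)); last by rewrite invr_gt0 mulr_gt0 ?exprn_gt0.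
rewrite ler_pdivrMr ?mulr_gt0 ?exprn_gt0// normrM distrC (gtr0_norm (x := L j + l j)); last by lra.
apply: (@le_trans _ _ (e * g j * (3 * g j))).
  by apply: ler_pM => //; lra.
have h1 : (g j / 8) ^+ 2 <= l j ^+ 2 by rewrite lerXn2r// ?nnegrE; lra.
have h2 : (g j / 2) ^+ 2 <= L j ^+ 2 by rewrite lerXn2r// ?nnegrE; lra.
have h3 : (g j / 8) ^+ 2 * (g j / 2) ^+ 2 <= l j ^+ 2 * L j ^+ 2.
  by apply: ler_pM; rewrite ?sqr_ge0.
have c0 : 0 <= 768 * e / g j ^+ 2 by apply: divr_ge0; [lra|exact: sqr_ge0].
have := ler_wpM2l c0 h3.
rewrite (_ : 768 * e / g j ^+ 2 * ((g j / 8) ^+ 2 * (g j / 2) ^+ 2) =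
  e * g j * (3 * g j)); last by field; rewrite gt_eqF.
by rewrite -!mulrA.
Qed.

Let M_le j : (j <= J)%N -> `|M j| <= 5 * g j * u ^+ (3 * j).
Proof.
move=> jJ; have gj := g0 _ jJ.
rewrite -(subrK (g j / 2 * B j) (M j)) (le_trans (ler_normD _ _))//.
have h1 := MB _ jJ; have h2 := B_le _ jJ.
have h3 : u ^+ (5 * j) <= u ^+ (3 * j) by apply: ratioX_anti; rewrite leq_mul2r orbT.
have h4 := ler_wpM2l (ltW gj) h3; have h5 := ler_wpM2l (ltW gj) h2.
rewrite normrM (gtr0_norm (x := g j / 2)); last by lra.
have h6 := mulr_gt0 gj (@ratioX_gt0 R (3 * j)).
by move: h1 h4 h5 h6; move: (u ^+ (5 * j)) (u ^+ (3 * j)) => ? ? ? ? ? ?; lra.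
Qed.

Let term j : (j <= J)%N -> 2 ^+ j / g j * u ^+ (5 * j) = u ^+ j * amplitude j.
Proof.
move=> jJ; rewrite /amplitude (_ : 5 * j = 4 * j + j)%N; last by rewrite -mulSnr.
by rewrite exprD; ring.
Qed.

(** The numerator is the main term with the deterministic weights [v], plus the linearisation error
    under [v], plus the weight error times [M]. The last two are summable in j; the total weight is
    at least [info ^+ 2 / 4]. *)
Lemma weighted_combination_le :
  `|\sum_(j < J.+1) w j / (\sum_(t < J.+1) w t) * M j| <= 212 * 1000 / info.
Proof.
have i0 := info_gt0.
have W0 : 0 < \sum_(t < J.+1) w t.
  by rewrite (lt_le_trans _ sum_weight_ge)// divr_gt0// exprn_gt0.
have -> : \sum_(j < J.+1) w j / (\sum_(t < J.+1) w t) * M j =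
    (\sum_(j < J.+1) w j * M j) / (\sum_(t < J.+1) w t).
  by rewrite mulr_suml; apply: eq_bigr => j _; rewrite mulrAC.
have num : `|\sum_(j < J.+1) w j * M j| <= 53 * 1000 * info.
  have -> : \sum_(j < J.+1) w j * M j = \sum_(j < J.+1) v j * (g j / 2 * B j) +
     (\sum_(j < J.+1) (v j * (M j - g j / 2 * B j) + (w j - v j) * M j)).
    by rewrite -big_split/=; apply: eq_bigr => j _; ring.
  rewrite (le_trans (ler_normD _ _))//.
  (* Weight error and mid-summary both have relative size u^(3j); their product u^(6j) is below
     u^(5j), the order of the linearisation error. The constants add up to 16 + 768 * 5 <= 4000. *)
  have rest : `|\sum_(j < J.+1) (v j * (M j - g j / 2 * B j) + (w j - v j) * M j)|
     <= 4 * 1000 * (13 * info).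
    rewrite (le_trans (ler_norm_sum _ _ _))//.
    apply: (@le_trans _ _ (4 * 1000 * \sum_(j < J.+1) u ^+ j * amplitude j)); last first.
      by apply: ler_wpM2l; [lra|exact: sum_ratio_amp_le].
    rewrite mulr_sumr; apply: ler_sum => j _.
    have jJ : (j <= J)%N by rewrite -ltnS.
    have gj := g0 _ jJ; have Lj := L_lo _ jJ.
    rewrite -term// (le_trans (ler_normD _ _))// (normrM (v j)) (normrM (w j - v j)).
    have v0 : 0 <= v j by rewrite divr_ge0 ?exprn_ge0//; lra.
    have t1 : `|v j| * `|M j - g j / 2 * B j| <= 16 * (2 ^+ j / g j * u ^+ (5 * j)).
      rewrite ger0_norm//.
      apply: (@le_trans _ _ (4 * 2 ^+ j / g j ^+ 2 * (4 * g j * u ^+ (5 * j)))).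
        by apply: ler_pM => //; [exact: v_le|exact: MB].
      by rewrite le_eqVlt; apply/orP; left; apply/eqP; field; rewrite gt_eqF.
    have t2 : `|w j - v j| * `|M j| <= 768 * 5 * (2 ^+ j / g j * u ^+ (5 * j)).
      apply: (@le_trans _ _ (768 * u ^+ (3 * j) * (2 ^+ j / g j ^+ 2) * (5 * g j * u ^+ (3 * j)))).
        by apply: ler_pM; [exact: normr_ge0|exact: normr_ge0|exact: wv_le|exact: M_le].
      rewrite (_ : _ * (5 * g j * _) = 768 * 5 * (2 ^+ j / g j * u ^+ (6 * j))).
        apply: ler_wpM2l; first by lra.
        apply: ler_wpM2l; first by rewrite divr_ge0 ?exprn_ge0// ltW.
        by apply: ratioX_anti; rewrite leq_mul2r orbT.
      rewrite (_ : 6 * j = 3 * j + 3 * j)%N; last by rewrite -mulnDl.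
      by rewrite exprD; field; rewrite gt_eqF.
    have X0 : 0 < 2 ^+ j / g j * u ^+ (5 * j).
      by rewrite mulr_gt0 ?ratioX_gt0// divr_gt0 ?exprn_gt0.
    by move: t1 t2 X0; move: (2 ^+ j / g j * _) => ? ? ? ?; lra.
  apply: (le_trans (lerD main_le rest)); lra.
rewrite normrM (gtr0_norm (x := _^-1)) ?invr_gt0// (ler_pdivrMr _ _ W0); apply: (le_trans num).
apply: (@le_trans _ _ (212 * 1000 / info * (info ^+ 2 / 4))); last first.
  apply: ler_wpM2l; last exact: sum_weight_ge.
  by apply: divr_ge0; [lra|exact: ltW].
rewrite (_ : 212 * 1000 / info * (info ^+ 2 / 4) = 53 * 1000 * info); first lra.
by field; rewrite gt_eqF.
Qed.

End Weights.

(** * Concentration of the linearised estimator *)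

Section Sample.
Context {d : measure_display} {T : measurableType d} {R : realType}.
Variable P : probability T R.
Variables (f : R -> R) (hf : SUMHR f) (mu : R).
Variables (m : nat) (Z : 'I_m -> {RV P >-> R}).
Hypothesis indZ : mutually_independent Z.
Hypothesis densZ : forall i, has_density (Z i) (translate f mu).
Hypothesis m0 : (0 < m)%N.
Local Notation S := (tail f).

(* Right ([true]) and left ([false]) tails, mirrored about the center [mu]. *)
Definition side (b : bool) (x : R) : set R :=
  if b then [set v | mu + x < v] else [set v | v <= mu - x].

Lemma measurable_side b x : measurable (side b x).
Proof.
have -> : side b x = if b then `]mu + x, +oo[%classic else `]-oo, mu - x]%classic.
  by case: b; apply/seteqP; split => v /=; rewrite in_itv/= ?andbT.
by case: b; exact: measurable_itv.
Qed.

Lemma probability_side i b x : P (Z i @^-1` side b x) = (S x)%:E.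
Proof.
have -> : P (Z i @^-1` side b x) = distribution P (Z i) (side b x) by [].
rewrite densZ; last exact: measurable_side.
pose D (c : bool) : set R := if c then `]x, +oo[%classic else `]-oo, - x]%classic.
have mD c : measurable (D c) by rewrite /D; case: c; exact: measurable_itv.
have -> : side b x = (fun v => 1 * v + - mu) @^-1` D b.
  rewrite /side /D; case: (b); apply/seteqP; split => v /=;
    rewrite in_itv/= ?andbT mul1r; lra.
have := @integral_isometry R 1 (- mu) (or_introl erefl) (D b) f (mD b)
  (sumhr_measurable f hf) (sumhr_ge0 f hf).
rewrite (massE f hf)//; under eq_integral do rewrite mul1r; move=> h.
transitivity (mass f (D b))%:E; first exact: h.
rewrite /D; case: (b) => //; congr EFin.
by rewrite mass_Ny// tail_opp// opprB addrCA subrr addr0.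
Qed.

Lemma side_sub b x y : x <= y -> side b y `<=` side b x.
Proof. by move=> xy; case: b => v /=; lra. Qed.

Lemma probability_side_diff i b x y : x <= y ->
  P (Z i @^-1` (side b x `\` side b y)) = (S x - S y)%:E.
Proof.
move=> xy.
have mZ A : measurable A -> measurable (Z i @^-1` A).
  by move=> mA; rewrite -[X in measurable X]setTI; exact: measurable_funP.
rewrite (_ : _ @^-1` _ = (Z i @^-1` side b x) `\` (Z i @^-1` side b y))//.
rewrite measureD; [|apply: mZ; exact: measurable_side|apply: mZ; exact: measurable_side|].
  rewrite setIidr; last by move=> w; exact: side_sub.
  by rewrite EFinB; congr (_ - _)%E; exact: probability_side.
by apply: (le_lt_trans (probability_le1 _ _)); [apply: mZ; exact: measurable_side|exact: ltry].
Qed.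

Lemma hits_diff b x y w : x <= y ->
  hits P Z (side b x) w - hits P Z (side b y) w = hits P Z (side b x `\` side b y) w.
Proof.
move=> xy; rewrite /hits -sumrB; apply: eq_bigr => i _.
rewrite in_setD; have [xin|xin] := boolP (Z i w \in side b x).
  by case: (Z i w \in side b y); rewrite ?subrr ?subr0.
rewrite (_ : (Z i w \in side b y) = false) ?subrr//.
by apply/negbTE/negP; rewrite inE => /(side_sub _ _ _ xy) h; move: xin; rewrite mem_set.
Qed.

Local Notation q := (quantile f).

Lemma level_deviation b a sbar eta :
  0 < a -> a < 1 -> a <= sbar -> 0 <= eta -> eta <= 2 * m%:R * sbar ->
  (P [set w | (eta <= `|hits P Z (side b (q a)) w - m%:R * a|)%R] <=
   (2 * expR (- (eta ^+ 2 / (4 * m%:R * sbar))))%:E)%E.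
Proof.
move=> a0 a1 as_ e0 es; apply: hits_deviation => //.
- exact: measurable_side.
- by move=> i; rewrite probability_side tail_quantile.
- exact: lt_le_trans a0 as_.
Qed.

(** An increment of the tail count is the count between two quantiles, of probability s |e|. The
    sign of e decides which tail contains the other; for e = 0 the set is empty. *)
Lemma grid_deviation b s e sbar eta :
  0 < s -> s < 1 -> 0 < s * (1 + e) -> s * (1 + e) < 1 -> s * `|e| <= sbar ->
  0 < sbar -> 0 <= eta -> eta <= 2 * m%:R * sbar ->
  (P [set w | (eta <= `|hits P Z (side b (q (s * (1 + e)))) w -
       hits P Z (side b (q s)) w - m%:R * s * e|)%R] <=
   (2 * expR (- (eta ^+ 2 / (4 * m%:R * sbar))))%:E)%E.
Proof.
move=> s0 s1 se0 se1 seb sb0 e0 es.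
have S1 := tail_quantile f hf _ s0 s1; have S2 := tail_quantile f hf _ se0 se1.
have key x y c : x <= y -> S x - S y = c -> c <= sbar ->
    (P [set w | (eta <= `|hits P Z (side b x `\` side b y) w - m%:R * c|)%R] <=
     (2 * expR (- (eta ^+ 2 / (4 * m%:R * sbar))))%:E)%E.
  move=> xy xyc cs; apply: hits_deviation => //.
    by apply: measurableD; exact: measurable_side.
  by move=> i; rewrite probability_side_diff// xyc.
have ord x y : S y < S x -> x <= y by move=> /(tail_lt_anti f hf)/ltW.
have [->|e_neq0] := eqVneq e 0.
  rewrite (_ : [set w | _] = [set w | eta <= `|hits P Z (side b (q s) `\` side b (q s)) w - m%:R * 0|]).
    by apply: key; rewrite ?subrr// ltW.
  apply/seteqP; split => w /=; rewrite addr0 mulr1 subrr -hits_diff// subrr.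
    by rewrite !mulr0.
  by rewrite !mulr0.
have [ege|elt] := leP 0 e.
  have qq : q (s * (1 + e)) <= q s.
    apply: ord; rewrite S1 S2 mulrDr mulr1 ltrDl mulr_gt0//.
    by rewrite lt_neqAle eq_sym e_neq0.
  rewrite (_ : [set w | _] = [set w | eta <=
    `|hits P Z (side b (q (s * (1 + e))) `\` side b (q s)) w - m%:R * (s * e)|]).
    apply: key => //; first by rewrite S1 S2; ring.
    by rewrite -(ger0_norm ege).
  by apply/seteqP; split => w /=; rewrite -hits_diff// mulrA.
have qq : q s <= q (s * (1 + e)).
  by apply: ord; rewrite S1 S2 mulrDr mulr1 gtrDl pmulr_rlt0.
rewrite (_ : [set w | _] = [set w | eta <=
  `|hits P Z (side b (q s) `\` side b (q (s * (1 + e)))) w - m%:R * (s * - e)|]).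
  apply: key => //; first by rewrite S1 S2; ring.
  by rewrite -(ltr0_norm elt).
apply/seteqP; split => w /=; rewrite -hits_diff// -normrN;
  by congr (_ <= `|_|); ring.
Qed.

(** * Deviation of the main linear term *)

Section MainTerm.
Variables (J : nat) (p : R) (x g L : nat -> R).
Hypothesis p0 : 0 < p.
Hypothesis x_ge0 : forall j, (j <= J)%N -> 0 <= x j.
Hypothesis Sx : forall j, (j <= J)%N -> S (x j) = 2 ^+ j * p.
Hypothesis x_anti : forall i j, (i <= j)%N -> (j <= J)%N -> x j <= x i.
Hypothesis g0 : forall j, (j <= J)%N -> 0 < g j.
Hypothesis L_lo : forall j, (j <= J)%N -> g j / 2 <= L j.
Local Notation u := (@ratio R).
Local Notation info := (@info R J g).
Local Notation amp := (@amplitude R g).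

Let c j : R := 2 ^+ j / L j ^+ 2 * (g j / 2) / (m%:R * (2 ^+ j * p)).
Let N b j w : R := hits P Z (side b (x j)) w.

Let mR : 0 < m%:R :> R. Proof. by rewrite ltr0n. Qed.
Let mp0 : 0 < m%:R * p. Proof. by rewrite mulr_gt0. Qed.

Let c_ge0 j : (j <= J)%N -> 0 <= c j.
Proof.
move=> jJ; have gj := g0 _ jJ; have Lj := L_lo _ jJ.
have L2 : 0 < L j ^+ 2 by rewrite exprn_gt0//; lra.
have e2 : 0 < 2 ^+ j :> R by rewrite exprn_gt0.
rewrite ltW// /c divr_gt0//; first by rewrite mulr_gt0 ?divr_gt0.
by rewrite mulr_gt0// mulr_gt0.
Qed.

Let c_le j : (j <= J)%N -> c j <= 2 / (m%:R * p) * (u ^+ (4 * j) * amp j).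
Proof.
move=> jJ; have gj := g0 _ jJ; have Lj := L_lo _ jJ.
have -> : u ^+ (4 * j) * amp j = (g j)^-1.
  rewrite /amplitude mulrA mulrCA -exprD -mulnDl two_ratioX mul1r//.
have L0 : 0 < L j by lra.
have e2 : 0 < 2 ^+ j :> R by rewrite exprn_gt0.
have -> : c j = (2 * (m%:R * p))^-1 * (g j / L j ^+ 2).
  by rewrite /c; field; rewrite !gt_eqF.
have h : g j / L j ^+ 2 <= 4 / g j.
  rewrite ler_pdivrMr ?exprn_gt0// mulrAC ler_pdivlMr//.
  have : (g j / 2) ^+ 2 <= L j ^+ 2 by rewrite lerXn2r// ?nnegrE; lra.
  lra.
apply: (@le_trans _ _ ((2 * (m%:R * p))^-1 * (4 / g j))).
  by apply: ler_wpM2l => //; rewrite invr_ge0 mulr_ge0// ltW.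
by rewrite le_eqVlt; apply/orP; left; apply/eqP; field; rewrite !gt_eqF.
Qed.

(** [chernoff] is applied to all tails on both sides at once, with opposite signs so that the means
    cancel. The second moments, weighted by the coefficients, reduce to the kernel of [schur_le]. *)
Lemma main_deviation :
  (P [set w | (28 * info <= `|\sum_(j < J.+1) c j * (N true j w - N false j w)|)%R]
   <= (2 * expR (- (3 / 2 * (m%:R * p))))%:E)%E.
Proof.
have i0 : 0 < info by exact: info_gt0.
(* Chosen so that the absolute coefficients sum to at most 1. The second-moment term is then at most
   2/7 m p and the threshold is 2 m p, leaving more than 3/2 m p. *)
pose la := m%:R * p / (14 * info).
have la0 : 0 < la by rewrite divr_gt0// mulr_gt0.
pose B : finType := ('I_J.+1 * bool)%type.
pose A (jb : B) := side jb.2 (x jb.1).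
pose sg (b : bool) : R := if b then 1 else -1.
pose co (e : R) (jb : B) : R := e * la * (sg jb.2 * c jb.1).
have jJ (j : 'I_J.+1) : (j <= J)%N by rewrite -ltnS.
have sumB (F : 'I_J.+1 -> bool -> R) :
    \sum_(jb : B) F jb.1 jb.2 = \sum_(j < J.+1) (F j true + F j false).
  rewrite -(pair_bigA _ F)/=; apply: eq_bigr => j _; exact: big_bool.
have sumE (e : R) w : \sum_(i < m) \sum_b co e b * (Z i w \in A b)%:R =
    e * la * \sum_(j < J.+1) c j * (N true j w - N false j w).
  rewrite exchange_big/= (eq_bigr (fun jb : B => e * la * (sg jb.2 * c jb.1) * N jb.2 jb.1 w)).
    rewrite (sumB (fun j b => e * la * (sg b * c j) * N b j w)) mulr_sumr.
    by apply: eq_bigr => j _; rewrite /sg; ring.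
  by move=> jb _; rewrite -mulr_sumr.
have key (e : R) : `|e| = 1 ->
    (P [set w | (la * (28 * info) <= e * la * \sum_(j < J.+1) c j * (N true j w - N false j w))%R]
     <= (expR (- (3 / 2 * (m%:R * p))))%:E)%E.
  move=> e1.
  have e2 : e * e = 1 by rewrite -expr2 -real_normK ?num_real// e1 expr1n.
  pose s2 (a b : B) : R := if a.2 == b.2 then 2 ^+ (minn a.1 b.1) * p else 0.
  have h := @chernoff _ _ _ P _ Z B A (co e) (fun jb => 2 ^+ jb.1 * p) s2 (la * (28 * info)) indZ.
  have h1 : \sum_b `|co e b| <= 1.
    rewrite (eq_bigr (fun jb : B => la * c jb.1)); last first.
      move=> [j b] _; rewrite /co/= normrM normrM e1 mul1r (gtr0_norm la0) normrM.
      rewrite (ger0_norm (c_ge0 _ (jJ j))) /sg.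
      by case: b; rewrite ?normrN1 ?normr1 mul1r.
    rewrite (sumB (fun j _ => la * c j)).
    apply: (@le_trans _ _ (2 * la * (2 / (m%:R * p)) * \sum_(j < J.+1) u ^+ (4 * j) * amp j)).
      rewrite mulr_sumr; apply: ler_sum => j _.
      have := ler_wpM2l (ltW la0) (c_le _ (jJ j)); lra.
    apply: (@le_trans _ _ (2 * la * (2 / (m%:R * p)) * (7 / 2 * info))).
      apply: ler_wpM2l; last exact: sum_ratio4_amp_le.
      by apply: ltW; apply: mulr_gt0; [exact: mulr_gt0|exact: divr_gt0].
    rewrite le_eqVlt; apply/orP; left; apply/eqP; rewrite /la; field.
    by rewrite !gt_eqF.
  have h2 i b : P (Z i @^-1` A b) = (2 ^+ b.1 * p)%:E.
    by rewrite probability_side Sx.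
  (* Tails on the same side are nested, tails on opposite sides disjoint. *)
  have h3 i a b : P (Z i @^-1` (A a `&` A b)) = (s2 a b)%:E.
    case: a b => [j a] [j' b]; rewrite /s2 /A/=; case: eqP => [<-|ab].
      have [jj'|jj'] := leqP j j'.
        by rewrite setIidl ?probability_side ?Sx//; apply: side_sub; exact: x_anti.
      rewrite setIidr ?probability_side ?Sx//; apply: side_sub.
      by apply: x_anti => //; exact: ltnW.
    rewrite (_ : _ `&` _ = set0) ?preimage_set0 ?measure0//.
    have xj := x_ge0 _ (jJ j); have xj' := x_ge0 _ (jJ j').
    by apply/seteqP; split => v //; rewrite /side; case: a b ab => -[]//= _ []; lra.
  have := h _ h1 h2 h3.
  under eq_set do rewrite sumE.
  move=> /(_ _)/le_trans; apply; first by move=> b; exact: measurable_side.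
  rewrite lee_fin ler_expR.
  have -> : \sum_b co e b * (2 ^+ b.1 * p) = 0.
    rewrite (sumB (fun j b => e * la * (sg b * c j) * (2 ^+ j * p))).
    by apply: big1 => j _; rewrite /sg; ring.
  have S2 : \sum_a \sum_b co e a * co e b * s2 a b =
      2 * la ^+ 2 * p * \sum_(i < J.+1) \sum_(j < J.+1) c i * c j * 2 ^+ minn i j.
    rewrite (sumB (fun i a => \sum_(b : B) e * la * (sg a * c i) * co e b * s2 (i, a) b)).
    rewrite mulr_sumr; apply: eq_bigr => i _.
    rewrite -big_split/= (sumB (fun j b =>
       e * la * (sg true * c i) * (e * la * (sg b * c j)) * s2 (i, true) (j, b) +
       e * la * (sg false * c i) * (e * la * (sg b * c j)) * s2 (i, false) (j, b))).
    rewrite mulr_sumr; apply: eq_bigr => j _; rewrite /s2 /sg/=.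
    have -> : forall a, 2 * la ^+ 2 * p * a = 2 * (e * e) * la ^+ 2 * p * a.
      by move=> a; rewrite e2 mulr1.
    ring.
  have S3 : \sum_(i < J.+1) \sum_(j < J.+1) c i * c j * 2 ^+ minn i j <=
      (2 / (m%:R * p)) ^+ 2 * (7 * info ^+ 2).
    apply: (@le_trans _ _ ((2 / (m%:R * p)) ^+ 2 * \sum_(i < J.+1) \sum_(j < J.+1)
      amp i * amp j * (u ^+ 4) ^+ (maxn i j - minn i j))); last first.
      by apply: ler_wpM2l; [exact: sqr_ge0|exact: schur_le].
    rewrite mulr_sumr; apply: ler_sum => i _; rewrite mulr_sumr; apply: ler_sum => j _.
    (* 4 (i + j) = 8 min(i, j) + 4 |i - j|, and the part with 8 cancels 2^min(i, j). *)
    have E : 2 ^+ minn i j * (u ^+ (4 * i) * u ^+ (4 * j)) = (u ^+ 4) ^+ (maxn i j - minn i j).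
      rewrite -exprM -exprD -mulnDr.
      have -> : (4 * (i + j) = 8 * minn i j + 4 * (maxn i j - minn i j))%N.
        by case: leqP; lia.
      by rewrite exprD mulrA two_ratioX mul1r.
    rewrite -E; apply: (@le_trans _ _ ((2 / (m%:R * p) * (u ^+ (4 * i) * amp i)) *
       (2 / (m%:R * p) * (u ^+ (4 * j) * amp j)) * 2 ^+ minn i j)).
      apply: ler_wpM2r; first by rewrite exprn_ge0.
      by apply: ler_pM; rewrite ?c_ge0 ?c_le.
    by rewrite le_eqVlt; apply/orP; left; apply/eqP; ring.
  rewrite add0r S2.
  have : 2 * la ^+ 2 * p * \sum_(i < J.+1) \sum_(j < J.+1) c i * c j * 2 ^+ minn i j <=
     2 * la ^+ 2 * p * ((2 / (m%:R * p)) ^+ 2 * (7 * info ^+ 2)).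
    by apply: ler_wpM2l S3; apply: ltW; rewrite mulr_gt0// mulr_gt0// exprn_gt0.
  move=> /(ler_wpM2l (ltW mR)).
  have -> : m%:R * (2 * la ^+ 2 * p * ((2 / (m%:R * p)) ^+ 2 * (7 * info ^+ 2))) = 2 / 7 * (m%:R * p).
    by rewrite /la; field; rewrite !gt_eqF.
  have -> : la * (28 * info) = 2 * (m%:R * p) by rewrite /la; field; rewrite !gt_eqF.
  have := mp0; lra.
have mN b j : measurable_fun setT (N b j).
  by apply: measurable_hits; exact: measurable_side.
have mT : measurable_fun setT (fun w => \sum_(j < J.+1) c j * (N true j w - N false j w)).
  apply: measurable_sum => j; apply: measurable_funM => //.
  exact: measurable_funB.
apply: (le_trans (@le_finite_union _ _ _ P bool (fun b => [set w | la * (28 * info) <=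
   (-1) ^+ b * la * \sum_(j < J.+1) c j * (N true j w - N false j w)]) _ _ _ _)).
- apply: measurable_superlevel; exact: measurableT_comp.
- by move=> b; apply: measurable_superlevel; apply: measurable_funM.
- move=> w /=; rewrite ler_normr => /orP[h|h]; [exists false|exists true] => //=.
    by rewrite expr0 mul1r ler_pM2l.
  by rewrite expr1 mulN1r mulNr -mulrN ler_pM2l.
rewrite big_bool/= (_ : forall y : R, 2 * y = y + y); last by move=> y; ring.
rewrite EFinD; apply: leeD.
  by have := key (-1) (normrN1 _); rewrite expr1.
by have := key 1 (normr1 _); rewrite expr0.
Qed.

End MainTerm.

End Sample.

(** * The deterministic estimate on the good event *)

Section Core.
Context {R : realType}.
Variables (f : R -> R) (hf : SUMHR f).
Variables (m k J : nat).
Local Notation S := (tail f).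
Local Notation q := (quantile f).
Local Notation u := (@ratio R).

Definition level (j : nat) : R := 2 ^+ j * (k%:R / m.+1%:R).
(* Relative to [level j]: the fluctuation allowed to the tail counts, the spacing
   of the grid on which their increments are controlled, and the extent of that
   grid. *)
Definition window (j : nat) : R := u ^+ (3 * j) / 4.
Definition mesh (j : nat) : R := u ^+ (5 * j) / 4.
Definition reach (j : nat) : R := 4 / 5 * u ^+ (3 * j).
(** [node], [scale] and [gap] are the q s_j, g_j and L_j of the outline. *)
Definition node (j : nat) : R := q (level j).
Definition scale (j : nat) : R := level j / f (node j).
Definition gap (j : nat) : R := node j - node j.+1.

Hypothesis m0 : (0 < m)%N.
Hypothesis k720 : 720 <= k%:R :> R.
Hypothesis levelJ : level J <= 4^-1.

Let mR : 0 < m%:R :> R. Proof. by rewrite ltr0n. Qed.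
Let m1R : 0 < m.+1%:R :> R. Proof. by rewrite ltr0n. Qed.
Let kR : 0 < k%:R :> R. Proof. by apply: lt_le_trans k720; lra. Qed.

Lemma level_gt0 j : 0 < level j.
Proof. by rewrite /level mulr_gt0 ?exprn_gt0// divr_gt0. Qed.

Lemma levelS j : level j.+1 = 2 * level j.
Proof. by rewrite /level exprS -!mulrA. Qed.

Lemma level_mono i j : (i <= j)%N -> level i <= level j.
Proof. by move=> ij; rewrite /level ler_pM2r ?divr_gt0// ler_weXn2l// ler1n. Qed.

Lemma level_le4 j : (j <= J)%N -> level j <= 4^-1.
Proof. by move=> jJ; rewrite (le_trans _ levelJ)// level_mono. Qed.

Lemma level_le2 j : (j <= J.+1)%N -> level j <= 2^-1.
Proof.
by move=> jJ; rewrite (le_trans (level_mono _ _ jJ))// levelS; move: levelJ; lra.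
Qed.

Lemma rank_level j : (2 ^ j * k)%:R = (m%:R + 1) * level j :> R.
Proof.
by rewrite /level natrM natrX natr1 [RHS]mulrC -mulrA divfK//.
Qed.

Lemma window_gt0 j : 0 < window j.
Proof. by rewrite /window divr_gt0// ratioX_gt0. Qed.

Lemma window_le j : window j <= 4^-1.
Proof. by rewrite /window; have := @ratioX_le1 R (3 * j); move: (u ^+ _) => ?; lra. Qed.

Lemma windowS j : window j.+1 <= window j.
Proof. by rewrite /window ler_pM2r ?invr_gt0// ratioX_anti// leq_mul2l leqnSn orbT. Qed.

(** Absorbs the mismatch between the rank (m + 1) s_j and the expected count m s_j. Since 2^j k is
    at most (m + 1) / 2 and k >= 720, m is at least 720 * 2^j. *)
Lemma inv_size_le j : (j <= J.+1)%N -> m%:R^-1 <= window j / 100.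
Proof.
move=> jJ.
have h1 : 2 ^+ j * k%:R <= 2^-1 * m.+1%:R :> R.
  by have := level_le2 _ jJ; rewrite /level mulrA ler_pdivrMr.
have h2 : u ^+ (8 * j) <= u ^+ (3 * j) by apply: ratioX_anti; rewrite leq_mul2r orbT.
have h3 := @two_ratioX R j.
have e2 : 0 < 2 ^+ j :> R by rewrite exprn_gt0.
have u8 := @ratioX_gt0 R (8 * j).
have h4 := ler_wpM2l (ltW e2) k720.
have h5 : 1 <= m%:R :> R by rewrite ler1n.
have h6 : 720 <= m%:R * u ^+ (8 * j).
  have : 2 ^+ j * 720 * u ^+ (8 * j) <= m%:R * u ^+ (8 * j).
    rewrite ler_pM2r//; move: h1 h4 h5; rewrite -[m.+1%:R]natr1.
    by move: (2 ^+ j) m%:R => E M *; lra.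
  by rewrite mulrAC h3 mul1r.
have h7 : m%:R * u ^+ (8 * j) <= m%:R * u ^+ (3 * j) by rewrite ler_pM2l.
rewrite /window -(ler_pM2l mR) mulfV ?gt_eqF// mulrA mulrA.
by move: h6 h7; move: (m%:R * u ^+ (8 * j)) (m%:R * u ^+ (3 * j)) => ? ? ? ?; lra.
Qed.

Let lev_ok j : (j <= J.+1)%N -> 0 < level j /\ level j < 1.
Proof. by move=> jJ; split; [exact: level_gt0|have := level_le2 _ jJ; lra]. Qed.

Lemma tail_node j : (j <= J.+1)%N -> S (node j) = level j.
Proof. by move=> jJ; have [h1 h2] := lev_ok _ jJ; exact: tail_quantile. Qed.

Lemma node_ge0 j : (j <= J.+1)%N -> 0 <= node j.
Proof. by move=> jJ; apply: quantile_ge0 => //; [exact: level_gt0|exact: level_le2]. Qed.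

Lemma density_node_gt0 j : (j <= J.+1)%N -> 0 < f (node j).
Proof.
by move=> jJ; rewrite sumhr_gt0// ?node_ge0// tail_node// level_gt0.
Qed.

Lemma scale_gt0 j : (j <= J.+1)%N -> 0 < scale j.
Proof. by move=> jJ; rewrite /scale divr_gt0 ?level_gt0 ?density_node_gt0. Qed.

Lemma node_decr j : (j <= J)%N -> node j.+1 < node j.
Proof.
move=> jJ; apply: (tail_lt_anti f hf); rewrite !tail_node ?levelS//; last exact: leqW.
by have := level_gt0 j; lra.
Qed.

Lemma node_anti i j : (i <= j)%N -> (j <= J)%N -> node j <= node i.
Proof.
elim: j => [|j IH]; first by rewrite leqn0 => /eqP ->.
rewrite leq_eqVlt ltnS => /orP[/eqP->//|ij] jJ.
by rewrite (le_trans (ltW (node_decr _ (ltnW jJ))))// IH// ltnW.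
Qed.

Lemma gap_le j : (j <= J)%N -> gap j <= scale j.
Proof.
move=> jJ; have j1 : (j <= J.+1)%N by exact: leqW.
have d := node_decr _ jJ; have F0 := density_node_gt0 _ j1.
rewrite /scale ler_pdivlMr// mulrC.
have := tail_sub_ge f hf (node j.+1) (node j) (node j) (ltW d).
rewrite !ger0_norm ?node_ge0// !tail_node// levelS => /(_ (ltW d) (lexx _)) /le_trans; apply.
lra.
Qed.

(** The tail at [a] is at most doubled, hence by the hazard rate so is the density. *)
Lemma density_le_double j a : (j <= J)%N -> 0 <= a -> S a <= 2 * level j ->
  level j <= S a -> f a <= 2 * f (node j).
Proof.
move=> jJ a0 Sa Sa'; have j1 : (j <= J.+1)%N by exact: leqW.
have F0 := density_node_gt0 _ j1; have l0 := level_gt0 j.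
have [an|na] := leP a (node j).
  have := sumhr_hazard_cross f hf a (node j) a0 an.
  rewrite tail_node// => h; rewrite -(ler_pM2r l0) (le_trans h)//.
  by have := ler_wpM2l (ltW F0) Sa; lra.
apply: (@le_trans _ _ (f (node j))); last by lra.
by rewrite sumhr_le// !ger0_norm ?node_ge0// ltW.
Qed.

Lemma gap_ge j : (j <= J)%N -> scale j / 2 <= gap j.
Proof.
move=> jJ; have j1 : (j <= J.+1)%N by exact: leqW.
have d := node_decr _ jJ; have F0 := density_node_gt0 _ j1.
have h := tail_sub_le f hf (node j.+1) (node j) (node_ge0 j.+1 jJ) (ltW d).
have F2 : f (node j.+1) <= 2 * f (node j).
  by apply: density_le_double; rewrite ?node_ge0// tail_node// levelS; have := level_gt0 j; lra.
have g0 : 0 <= node j - node j.+1 by rewrite subr_ge0 ltW.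
have := ler_wpM2r g0 F2; move: h; rewrite !tail_node// levelS => h1 h2.
by rewrite /scale /gap ler_pdivrMr// ler_pdivrMr//; lra.
Qed.

(** * Order statistics of one half sample *)

Section Half.
(** [N b x] stands for the count beyond x on side b, and [Y b j] for the order statistic of rank 2^j
    k from that end, measured outwards from the center. *)
Variables (N : bool -> R -> R) (Y : bool -> nat -> R).
Hypothesis NY : forall b j x, (j <= J.+1)%N -> (2 ^ j * k)%:R <= N b x -> x <= Y b j.
Hypothesis YN : forall b j x, (j <= J.+1)%N -> N b x < (2 ^ j * k)%:R -> Y b j <= x.

(** The index [e] encodes the relative shifts -1, 0 and 1 in units of [window]. The factor 9/10 in
    [level_tol] leaves a tenth of the window for the mismatch between m and m + 1. *)
Definition level_point (j : nat) (e : 'I_3) : R := level j * (1 + (e%:R - 1) * window j).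
Definition level_tol (j : nat) : R := 9 / 10 * (m%:R * level j * window j).

Hypothesis level_good : forall b j e, (j <= J.+1)%N ->
  `|N b (q (level_point j e)) - m%:R * level_point j e| < level_tol j.

Let point0 j : level_point j 0 = level j * (1 - window j).
Proof. by rewrite /level_point/= sub0r mulN1r. Qed.
Let point1 j : level_point j 1 = level j.
Proof. by rewrite /level_point/= subrr mul0r addr0 mulr1. Qed.
Let point2 j : level_point j 2 = level j * (1 + window j).
Proof. by rewrite /level_point/= (_ : 2%:R - 1 = 1 :> R) ?mul1r//; lra. Qed.

Lemma order_stat_ge b j : (j <= J.+1)%N -> q (level j * (1 + window j)) <= Y b j.
Proof.
move=> jJ; apply: NY => //; rewrite rank_level.
have := level_good b _ 2 jJ; rewrite ltr_norml point2 /level_tol => /andP[h _].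
have h2 := inv_size_le _ jJ; have l0 := level_gt0 j.
have ml0 : 0 < m%:R * level j by rewrite mulr_gt0.
have := ler_wpM2l (ltW ml0) h2; rewrite (mulrC m%:R) mulfK ?gt_eqF// => h3.
move: h; have := window_gt0 j; move: (window j) h3 => t h3 t0 h.
have := mulr_gt0 ml0 t0; lra.
Qed.

Lemma order_stat_le b j : (j <= J.+1)%N -> Y b j <= q (level j * (1 - window j)).
Proof.
move=> jJ; apply: YN => //; rewrite rank_level.
have := level_good b _ 0 jJ; rewrite ltr_norml point0 /level_tol => /andP[_ h].
have l0 := level_gt0 j.
have ml0 : 0 < m%:R * level j by rewrite mulr_gt0.
move: h; have := window_gt0 j; move: (window j) => t t0 h.
have := mulr_gt0 ml0 t0; lra.
Qed.

Lemma order_stat_dist b j : (j <= J)%N -> `|Y b j - node j| <= 2 * window j * scale j.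
Proof.
move=> jJ; have j1 : (j <= J.+1)%N by exact: leqW.
have lo := order_stat_ge b _ j1; have hi := order_stat_le b _ j1.
have l0 := level_gt0 j; have l4 := level_le4 _ jJ; have w0 := window_gt0 j.
have w4 := window_le j; have g0 := scale_gt0 _ j1.
have l2 : level j <= 2^-1 by lra.
have near e : `|e| = window j -> `|q (level j * (1 + e)) - node j| <= 2 * window j * scale j.
  move=> ew; have eb : `|e| <= 4^-1 by rewrite ew.
  move: (eb); rewrite ler_norml => /andP[e1 e2].
  have h1 : -1 < e by lra.
  have h2 : level j * (1 + e) <= 2^-1.
    by rewrite (le_trans (ler_wpM2l (ltW l0) (_ : 1 + e <= 2)))//; lra.
  have := quantile_expansion f hf _ _ l0 l2 h1 h2; rewrite -/(node j) -/(scale j).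
  set y := q _ - _ => h3.
  rewrite -(addrK (scale j * e) y) (le_trans (ler_normB _ _))//.
  rewrite (normrM (scale j)) ew (gtr0_norm g0).
  have h4 : e ^+ 2 / (1 + e) <= window j / 3.
    rewrite ler_pdivrMr; last by lra.
    have -> : e ^+ 2 = window j ^+ 2 by rewrite -ew real_normK ?num_real.
    have w3 : window j <= (1 + e) / 3 by lra.
    by have := ler_wpM2l (ltW w0) w3; rewrite expr2; lra.
  have h5 := le_trans h3 (ler_wpM2l (ltW g0) h4).
  have h6 := mulr_gt0 g0 w0.
  by move: h5 h6; move: (`|_|) => ? ? ?; lra.
have h1 := near (window j) (gtr0_norm w0).
have h2 := near (- window j); rewrite normrN in h2; have {}h2 := h2 (gtr0_norm w0).
move: h1 h2; rewrite !ler_norml => /andP[h1 _] /andP[_ h2].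
by apply/andP; split; lra.
Qed.

Lemma order_stat_dist_succ b j : (j <= J)%N ->
  `|Y b j.+1 - node j.+1| <= 2 * window j.+1 * scale j.
Proof.
move=> jJ; have j1 : (j <= J.+1)%N by exact: leqW.
have lo := order_stat_ge b _ (jJ : (j.+1 <= J.+1)%N).
have hi := order_stat_le b _ (jJ : (j.+1 <= J.+1)%N).
have l0 := level_gt0 j; have l4 := level_le4 _ jJ; have w0 := window_gt0 j.+1.
have w4 := window_le j.+1; have F0 := density_node_gt0 _ j1.
have n0 := node_ge0 _ j1.
have inside a : level j < S a -> S a < 1 - level j -> `|a| <= node j.
  move=> h1 h2; rewrite ler_norml; apply/andP; split; apply: ltW; apply: (tail_lt_anti f hf).
    by rewrite tail_opp// tail_node.
  by rewrite tail_node.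
have lS := levelS j.
have nS : `|node j.+1| <= node j by apply: inside; rewrite tail_node// lS; lra.
have near e : `|e| = window j.+1 ->
    `|q (level j.+1 * (1 + e)) - node j.+1| <= 2 * window j.+1 * scale j.
  move=> ew; have eb : `|e| <= 4^-1 by rewrite ew.
  move: (eb); rewrite ler_norml => /andP[e1 e2].
  have h0 : level j.+1 * (1 + e) <= 5 / 4 * level j.+1.
    by rewrite mulrC (ler_pM2r (level_gt0 j.+1)); lra.
  have h0' : 3 / 4 * level j.+1 <= level j.+1 * (1 + e).
    by rewrite [leRHS]mulrC (ler_pM2r (level_gt0 j.+1)); lra.
  have Sa : S (q (level j.+1 * (1 + e))) = level j.+1 * (1 + e).
    by apply: tail_quantile => //; lra.
  have aS : `|q (level j.+1 * (1 + e))| <= node j by apply: inside; rewrite Sa; lra.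
  have key : f (node j) * `|q (level j.+1 * (1 + e)) - node j.+1| <=
      `|level j.+1 * (1 + e) - level j.+1|.
    have Sn := tail_node _ (jJ : (j.+1 <= J.+1)%N).
    have [h|h] := leP (node j.+1) (q (level j.+1 * (1 + e))).
      have := tail_sub_ge f hf _ _ _ h nS aS; rewrite Sa Sn => h'.
      rewrite ger0_norm ?subr_ge0// (le_trans h')// distrC; exact: ler_norm.
    have := tail_sub_ge f hf _ _ _ (ltW h) aS nS; rewrite Sa Sn => h'.
    by rewrite distrC ger0_norm ?subr_ge0 ?(ltW h)// (le_trans h')//; exact: ler_norm.
  rewrite /scale mulrA ler_pdivlMr// mulrC (le_trans key)//.
  rewrite mulrDr mulr1 addrC addKr normrM ew gtr0_norm ?level_gt0// lS; lra.
have h1 := near (window j.+1) (gtr0_norm w0).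
have h2 := near (- window j.+1); rewrite normrN in h2; have {}h2 := h2 (gtr0_norm w0).
move: h1 h2; rewrite !ler_norml => /andP[h1 _] /andP[_ h2].
by apply/andP; split; lra.
Qed.

(** The two order statistics are separated by tail levels 5/4 s_j and 3/2 s_j, and the density in
    between is at most 2 f (node j). *)
Lemma spacing_ge b j : (j <= J)%N -> scale j / 8 <= Y b j - Y b j.+1.
Proof.
move=> jJ; have j1 : (j <= J.+1)%N by exact: leqW.
have lo := order_stat_ge b _ j1; have hi := order_stat_le b _ (jJ : (j.+1 <= J.+1)%N).
have l0 := level_gt0 j; have l4 := level_le4 _ jJ; have F0 := density_node_gt0 _ j1.
have w0 := window_gt0 j; have w4 := window_le j.
have w0' := window_gt0 j.+1; have w4' := window_le j.+1.
set a := q (level j.+1 * _) in hi; set c := q _ in lo.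
have e1 : level j.+1 * (1 - window j.+1) <= 2 * level j.
  by rewrite levelS ler_piMr; lra.
have e2 : 3 / 2 * level j <= level j.+1 * (1 - window j.+1).
  by rewrite levelS; have := ler_wpM2l (ltW l0) w4'; lra.
have e3 : level j * (1 + window j) <= 5 / 4 * level j.
  by have := ler_wpM2l (ltW l0) w4; lra.
have e4 : level j <= level j * (1 + window j) by rewrite ler_peMr; lra.
have Sa : S a = level j.+1 * (1 - window j.+1) by apply: tail_quantile => //; lra.
have Sc : S c = level j * (1 + window j) by apply: tail_quantile => //; lra.
have a0 : 0 <= a by apply: quantile_ge0 => //; lra.
have ac : a <= c by apply: ltW; apply: (tail_lt_anti f hf); rewrite Sa Sc; lra.
have h := tail_sub_le f hf a c a0 ac; rewrite Sa Sc in h.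
have F2 : f a <= 2 * f (node j) by apply: density_le_double; rewrite ?Sa//; lra.
have ca0 : 0 <= c - a by rewrite subr_ge0.
have h2 := ler_wpM2r ca0 F2.
apply: (@le_trans _ _ (c - a)); last by lra.
rewrite /scale mulrAC ler_pdivrMr//; lra.
Qed.

Hypothesis grid_good : forall b j (z : int), (j <= J)%N -> `|z%:~R * mesh j| <= reach j ->
  `|N b (q (level j * (1 + z%:~R * mesh j))) - N b (node j)
    - m%:R * level j * (z%:~R * mesh j)| < m%:R * level j * mesh j.

Lemma level_good_center b j : (j <= J.+1)%N ->
  `|N b (node j) - m%:R * level j| < level_tol j.
Proof. by move=> jJ; have := level_good b j 1 jJ; rewrite point1. Qed.

(** [bahadur] with grid step [mesh] and window [reach]. As [reach] is at most 4/5, the error is at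
    most 2 mesh + 5 reach^2, which is below 4 u^(5j). *)
Lemma order_stat_linear b j : (j <= J)%N ->
  `|Y b j - node j - scale j * ((N b (node j) - (m%:R + 1) * level j) / (m%:R * level j))|
  <= scale j * (4 * u ^+ (5 * j)).
Proof.
move=> jJ; have j1 : (j <= J.+1)%N by exact: leqW.
have l0 := level_gt0 j; have l4 := level_le4 _ jJ; have g0 := scale_gt0 _ j1.
have ml0 : 0 < m%:R * level j by rewrite mulr_gt0.
have u3 := @ratioX_gt0 R (3 * j); have u31 := @ratioX_le1 R (3 * j).
have u5 := @ratioX_gt0 R (5 * j).
have u53 : u ^+ (5 * j) <= u ^+ (3 * j) by apply: ratioX_anti; rewrite leq_mul2r orbT.
have u65 : u ^+ (3 * j) ^+ 2 <= u ^+ (5 * j).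
  by rewrite -exprM; apply: ratioX_anti; rewrite mulnAC leq_mul2r orbT.
have is_ := inv_size_le _ j1.
have e0 : 0 < mesh j by rewrite /mesh divr_gt0.
have W1 : reach j < 1 by rewrite /reach; move: (u ^+ _) u31 => a ?; lra.
have tW : window j + m%:R^-1 + 2 * mesh j <= reach j.
  move: is_; rewrite /window /mesh /reach; move: m%:R^-1 => mi.
  move: (u ^+ (3 * j)) (u ^+ (5 * j)) u3 u53 => a b' ? ? ?; lra.
have lW : level j * (1 + reach j) <= 2^-1.
  have W2 : 1 + reach j <= 9 / 5 by rewrite /reach; move: (u ^+ _) u31 => a ?; lra.
  by have := ler_wpM2l (ltW l0) W2; lra.
have YN' a : 0 < a -> a <= 2^-1 -> (m%:R + 1) * level j <= N b (q a) -> q a <= Y b j.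
  by move=> _ _ h; apply: NY => //; rewrite rank_level.
have NY' a : 0 < a -> a <= 2^-1 -> N b (q a) < (m%:R + 1) * level j -> Y b j <= q a.
  by move=> _ _ h; apply: YN => //; rewrite rank_level.
have E1 : `|N b (q (level j)) - m%:R * level j| <= m%:R * level j * window j.
  rewrite ltW// (lt_le_trans (level_good_center _ _ j1))// /level_tol.
  by have := mulr_gt0 ml0 (window_gt0 j); lra.
have := @bahadur _ f hf (fun a => N b (q a)) (Y b j) m%:R (level j) (window j)
  (mesh j) (reach j) l0 mR e0 tW W1 lW YN' NY' E1 (fun z => grid_good b j z jJ).
move=> /le_trans; apply; rewrite ler_pM2l//.
apply: (@le_trans _ _ (2 * mesh j + reach j ^+ 2 * 5)).
  rewrite lerD2l ler_wpM2l ?sqr_ge0//.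
  rewrite -[leRHS]invrK lef_pV2 ?posrE ?subr_gt0//.
  by rewrite /reach; move: (u ^+ _) u31 => a ?; lra.
rewrite /reach /mesh exprMn.
by move: (u ^+ (3 * j) ^+ 2) (u ^+ (5 * j)) u5 u65 => a c ? ?; lra.
Qed.

End Half.

(** * Combination of the main and hold-out halves *)

Variables (NM NH : bool -> R -> R) (YM YH : bool -> nat -> R).
Hypothesis NYM : forall b j x, (j <= J.+1)%N -> (2 ^ j * k)%:R <= NM b x -> x <= YM b j.
Hypothesis YNM : forall b j x, (j <= J.+1)%N -> NM b x < (2 ^ j * k)%:R -> YM b j <= x.
Hypothesis NYH : forall b j x, (j <= J.+1)%N -> (2 ^ j * k)%:R <= NH b x -> x <= YH b j.
Hypothesis YNH : forall b j x, (j <= J.+1)%N -> NH b x < (2 ^ j * k)%:R -> YH b j <= x.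
Hypothesis level_goodM : forall b j e, (j <= J.+1)%N ->
  `|NM b (q (level_point j e)) - m%:R * level_point j e| < level_tol j.
Hypothesis level_goodH : forall b j e, (j <= J.+1)%N ->
  `|NH b (q (level_point j e)) - m%:R * level_point j e| < level_tol j.
Hypothesis grid_goodM : forall b j (z : int), (j <= J)%N -> `|z%:~R * mesh j| <= reach j ->
  `|NM b (q (level j * (1 + z%:~R * mesh j))) - NM b (node j)
    - m%:R * level j * (z%:~R * mesh j)| < m%:R * level j * mesh j.
Hypothesis main_good :
  `|\sum_(j < J.+1) 2 ^+ j / gap j ^+ 2 * (scale j / 2) / (m%:R * level j) *
     (NM true (node j) - NM false (node j))| < 28 * @info R J scale.

Let lhat j : R := 2^-1 * ((YH true j - YH true j.+1) + (YH false j - YH false j.+1)).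
Let M j : R := 2^-1 * (YM true j - YM false j).
Let w j : R := 2 ^+ j / lhat j ^+ 2.

Let lhat_ge j : (j <= J)%N -> scale j / 8 <= lhat j.
Proof.
move=> jJ; have h1 := spacing_ge _ _ NYH YNH level_goodH true _ jJ.
have h2 := spacing_ge _ _ NYH YNH level_goodH false _ jJ.
rewrite /lhat; lra.
Qed.

Lemma weight_sum_gt0 : 0 < \sum_(j < J.+1) w j.
Proof.
rewrite big_ord_recl/=; apply: ltr_pwDl; last first.
  by apply: sumr_ge0 => j _; apply: divr_ge0; [exact: exprn_ge0|exact: sqr_ge0].
have h1 := lhat_ge 0 (leq0n _); have h2 := scale_gt0 0 (leq0n _).
by apply: divr_gt0; rewrite exprn_gt0//; lra.
Qed.

Lemma core_bound : `|\sum_(j < J.+1) w j / (\sum_(t < J.+1) w t) * M j|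
  <= 212 * 1000 / @info R J scale.
Proof.
pose B j : R := (NM true (node j) - NM false (node j)) / (m%:R * level j).
apply: (@weighted_combination_le R J scale _ gap lhat M B).
- by move=> j jJ; apply: scale_gt0; exact: leqW.
- exact: gap_ge.
- exact: gap_le.
- exact: lhat_ge.
(* Each side errs by at most 2 window j + 2 window (j + 1) in units of the scale, hence at most 4
   window j = u^(3j). *)
- move=> j jJ; have g0 := scale_gt0 _ (leqW jJ).
  have h1 := order_stat_dist _ _ NYH YNH level_goodH true _ jJ.
  have h2 := order_stat_dist _ _ NYH YNH level_goodH false _ jJ.
  have h3 := order_stat_dist_succ _ _ NYH YNH level_goodH true _ jJ.
  have h4 := order_stat_dist_succ _ _ NYH YNH level_goodH false _ jJ.
  have h5 := ler_wpM2r (ltW g0) (windowS j).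
  have -> : u ^+ (3 * j) * scale j = 4 * (window j * scale j).
    by rewrite /window; field.
  move: h1 h2 h3 h4; rewrite !ler_norml /lhat /gap.
  move=> /andP[a1 b1] /andP[a2 b2] /andP[a3 b3] /andP[a4 b4].
  by apply/andP; split; lra.
- move=> j jJ; have g0 := scale_gt0 _ (leqW jJ).
  have h1 := order_stat_linear _ _ NYM YNM level_goodM grid_goodM true _ jJ.
  have h2 := order_stat_linear _ _ NYM YNM level_goodM grid_goodM false _ jJ.
  have ml0 : 0 < m%:R * level j by rewrite mulr_gt0// level_gt0.
  (* The quantile and the centering (m + 1) s_j are common to both sides and cancel in the
     difference. *)
  have -> : M j - scale j / 2 * B j =
      2^-1 * ((YM true j - node j - scale j * ((NM true (node j) - (m%:R + 1) * level j) / (m%:R * level j)))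
      - (YM false j - node j - scale j * ((NM false (node j) - (m%:R + 1) * level j) / (m%:R * level j)))).
    by rewrite /M /B; field; rewrite !gt_eqF// level_gt0.
  rewrite normrM gtr0_norm ?invr_gt0// ler_pdivrMl//.
  rewrite (le_trans (ler_normB _ _))// (le_trans (lerD h1 h2))//.
  by rewrite le_eqVlt; apply/orP; left; apply/eqP; ring.
- move=> j jJ; have ml0 : 0 < m%:R * level j by rewrite mulr_gt0// level_gt0.
  have h1 := level_good_center _ level_goodM true _ (leqW jJ).
  have h2 := level_good_center _ level_goodM false _ (leqW jJ).
  rewrite normrM (gtr0_norm (x := _^-1)) ?invr_gt0// ler_pdivrMr//.
  have u3 := mulr_gt0 ml0 (@ratioX_gt0 R (3 * j)).
  move: h1 h2; rewrite /level_tol /window !ltr_norml => /andP[a1 b1] /andP[a2 b2].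
  move: a1 b1 a2 b2 u3; move: (u ^+ _) (m%:R * _) => a c *.
  by rewrite ler_norml; apply/andP; split; lra.
- move: main_good => /ltW; congr (`|_| <= _); apply: eq_bigr => j _.
  by rewrite /B mulrA -!mulrA; congr (_ * _); congr (_ * _); ring.
Qed.

End Core.

Lemma grid_surj (G n : nat) (z : int) : (G + G < n)%N -> `|z| <= G%:Z ->
  exists2 i, (i < n)%N & i%:Z - G%:Z = z.
Proof.
move=> Gn; rewrite ler_norml => /andP[h1 h2]; exists (absz (z + G%:Z)); lia.
Qed.

(** * Probability of the good event *)

Section UnionBound.
Context {d : measure_display} {T : measurableType d} {R : realType}.
Variable P : probability T R.
Variables (f : R -> R) (hf : SUMHR f) (mu : R).
Variables (m : nat) (Z : 'I_m -> {RV P >-> R}).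
Hypothesis indZ : mutually_independent Z.
Hypothesis densZ : forall i, has_density (Z i) (translate f mu).
Variables (k J : nat) (La : R).
Hypothesis m99 : 99 <= m%:R :> R.
Hypothesis La1 : 1 <= La.
Hypothesis kLa : 720 * La <= k%:R.
Hypothesis levelJ : level m k J <= 4^-1 :> R.
Local Notation S := (tail f).
Local Notation q := (quantile f).
Local Notation u := (@ratio R).
Local Notation level := (@level R m k).
Local Notation level_point := (@level_point R m k).
Local Notation level_tol := (@level_tol R m k).
Local Notation node := (@node R f m k).

Let m0 : (0 < m)%N.
Proof. by rewrite -(@ltr_nat R); apply: lt_le_trans m99; lra. Qed.
Let mR : 0 < m%:R :> R. Proof. by rewrite ltr0n. Qed.
Let La0 : 0 < La. Proof. by apply: lt_le_trans La1. Qed.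
Let k720 : 720 <= k%:R :> R.
Proof. by apply: le_trans kLa; have := ler_wpM2l (_ : 0 <= 720) La1; lra. Qed.

Lemma bernoulli_ratio j : (1 + j%:R / 12) * u ^+ j <= 1.
Proof.
have u0 := @ratio_gt0 R; have u1 := @ratio_le R.
elim: j => [|j IH]; first by rewrite mul0r addr0 mulr1.
apply: le_trans IH; rewrite exprS mulrA ler_pM2r ?ratioX_gt0//.
have j0 : 0 <= j%:R :> R by rewrite ler0n.
have j1 : 0 <= 1 + j.+1%:R / 12 :> R by rewrite -natr1; lra.
apply: (le_trans (ler_wpM2l j1 u1)); rewrite -natr1; lra.
Qed.

(** 2^j u^(ij) = u^(-(8 - i) j) grows geometrically for i <= 7; a linear lower bound suffices to
    make the failure probabilities summable over the levels. *)
Lemma linear_le_ratio i j : (i <= 7)%N -> 1 + j%:R / 12 <= 2 ^+ j * u ^+ (i * j).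
Proof.
move=> i7; have uX := @ratioX_gt0 R j.
rewrite -(ler_pM2r uX) (le_trans (bernoulli_ratio j))// -[leLHS](@two_ratioX R j) -mulrA -exprD.
by rewrite ler_pM2l ?exprn_gt0// ratioX_anti// -mulSnr leq_mul2r ltnS i7 orbT.
Qed.

Lemma size_level_ge j : 99 / 100 * (2 ^+ j * k%:R) <= m%:R * level j.
Proof.
have -> : m%:R * level j = m%:R * (2 ^+ j * k%:R) / m.+1%:R.
  by rewrite /level; move: (m.+1%:R^-1) => c; ring.
rewrite ler_pdivlMr ?ltr0n// -[m.+1%:R]natr1.
have : 0 <= 2 ^+ j * k%:R :> R by rewrite mulr_ge0 ?exprn_ge0.
move: (2 ^+ j * k%:R) => c c0; have := ler_wpM2r c0 m99; lra.
Qed.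

Definition level_bad_at (jbe : 'I_J.+2 * bool * 'I_3) : set T :=
  [set w | level_tol jbe.1.1 <=
    `|hits P Z (side mu jbe.1.2 (q (level_point jbe.1.1 jbe.2))) w
       - m%:R * level_point jbe.1.1 jbe.2|].

Lemma measurable_level_bad_at jbe : measurable (level_bad_at jbe).
Proof.
apply: measurable_superlevel; apply: measurableT_comp => //.
apply: measurable_funB => //; apply: measurable_hits; exact: measurable_side.
Qed.

Lemma level_bad_at_le jbe :
  (P (level_bad_at jbe) <= (2 * expR (- (7 * La * (1 + jbe.1.1%:R / 12))))%:E)%E.
Proof.
case: jbe => [[j b] e]; rewrite /level_bad_at/=.
have j1 : (j <= J.+1)%N by rewrite -ltnS.
have l0 := level_gt0 m k k720 j; have l2 := level_le2 m k J k720 levelJ j j1.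
have w0 := @window_gt0 R j; have w4 := @window_le R j.
have [e1 e2] : -1 <= e%:R - 1 :> R /\ e%:R - 1 <= 1 :> R.
  by case: e => -[|[|[|//]]] ?/=; split; lra.
have lw : level j * window j <= level j / 4.
  have := ler_wpM2l (ltW l0) w4; lra.
have lw0 : 0 < level j * window j by rewrite mulr_gt0.
have p1 : level_point j e <= 5 / 4 * level j.
  by rewrite /level_point; have := ler_wpM2r (ltW lw0) e2; lra.
have p0 : 3 / 4 * level j <= level_point j e.
  by rewrite /level_point; have := ler_wpM2r (ltW lw0) e1; lra.
have ml0 : 0 < m%:R * level j by rewrite mulr_gt0.
have mlw0 : 0 < m%:R * level j * window j by rewrite mulr_gt0.
have h := @level_deviation _ _ _ P f hf mu m Z indZ densZ m0 b (level_point j e)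
  (5 / 4 * level j) (level_tol j).
apply: (le_trans (h _ _ _ _ _)) => //.
- by lra.
- by lra.
- by rewrite /level_tol; lra.
- rewrite /level_tol; have := ler_wpM2l (ltW ml0) w4; lra.
rewrite lee_fin ler_pM2l// ler_expR lerN2.
have -> : level_tol j ^+ 2 / (4 * m%:R * (5 / 4 * level j)) =
    81 / 500 * (m%:R * level j * window j ^+ 2).
  by rewrite /level_tol; field; rewrite !gt_eqF.
have s1 := size_level_ge j; have s2 := linear_le_ratio 6 j isT.
have -> : window j ^+ 2 = u ^+ (6 * j) / 16.
  rewrite /window exprMn -exprM (_ : 3 * j * 2 = 6 * j)%N; last by rewrite mulnAC.
  by congr (_ * _); field.
have u6 := @ratioX_gt0 R (6 * j).
have s3 := ler_wpM2r (ltW u6) s1.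
have s4 : 0 < 1 + j%:R / 12 :> R by rewrite ltr_wpDr// divr_ge0.
have s5 : 720 * La * (1 + j%:R / 12) <= k%:R * (2 ^+ j * u ^+ (6 * j)).
  by apply: ler_pM kLa s2; [have := La0; lra|exact: ltW].
have s6 := mulr_gt0 La0 s4.
have s7 : 99 / 100 * (k%:R * (2 ^+ j * u ^+ (6 * j))) <= m%:R * level j * u ^+ (6 * j).
  by rewrite (_ : 99 / 100 * _ = 99 / 100 * (2 ^+ j * k%:R) * u ^+ (6 * j))//; ring.
(* The factor 720 of the rank enters here: 81/8000 * 99/100 * 720 exceeds 7. *)
rewrite (_ : 81 / 500 * _ = 81 / 8000 * (m%:R * level j * u ^+ (6 * j))); last by field.
rewrite -[7 * La * _]mulrA; rewrite -[720 * La * _]mulrA in s5.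
move: s5 s6 s7; move: (La * _) (k%:R * _) (m%:R * level j * _) => ? ? ? ? ? ?; lra.
Qed.

Lemma geometric_tail_le (a b c q0 : R) n : 0 < a -> expR (- (a / 12)) <= q0 ->
  0 <= b -> b * q0 < 1 -> 1 <= c * (1 - b * q0) ->
  \sum_(j < n) b ^+ j * expR (- (a * La * (1 + j%:R / 12))) <= c * expR (- (a * La)).
Proof.
move=> a0 aq b0 bq cq.
have q0_ge0 : 0 <= q0 by rewrite (le_trans _ aq)// expR_ge0.
apply: (@le_trans _ _ (expR (- (a * La)) * \sum_(j < n) (b * q0) ^+ j)).
  rewrite mulr_sumr; apply: ler_sum => j _.
  rewrite (_ : - (a * La * (1 + j%:R / 12)) = - (a * La) + j%:R * - (a * La / 12)); last by field.
  rewrite expRD expRM_natl mulrCA exprMn; apply: ler_wpM2l; first exact: expR_ge0.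
  apply: ler_wpM2l; first exact: exprn_ge0.
  rewrite lerXn2r ?nnegrE ?expR_ge0// (le_trans _ aq)// ler_expR lerN2.
  by rewrite ler_pM2r ?invr_gt0// ler_peMr// ltW.
rewrite mulrC; apply: ler_wpM2r; first exact: expR_ge0.
by apply: geometric_le => //; exact: mulr_ge0.
Qed.

Lemma expRN_le (x c : R) : 0 < c -> c^-1 <= 1 + x -> expR (- x) <= c.
Proof.
move=> c0 h; rewrite expRN -[leRHS]invrK lef_pV2 ?posrE ?expR_gt0 ?invr_gt0//.
exact: le_trans h (expR_ge1Dx _).
Qed.

Definition level_bad : set T := \bigcup_jbe level_bad_at jbe.

Lemma measurable_level_bad : measurable level_bad.
Proof.
apply: fin_bigcup_measurable; first exact: finite_finset.
by move=> jbe _; exact: measurable_level_bad_at.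
Qed.

(** 36 counts two signs, two sides, three points and a geometric sum of at most 3; e^(-7/12) <=
    12/19 comes from 1 + 7/12 = 19/12. *)
Lemma level_bad_le : (P level_bad <= (36 * expR (- (7 * La)))%:E)%E.
Proof.
apply: (le_trans (@le_finite_union _ _ _ P _ level_bad_at _ measurable_level_bad
  measurable_level_bad_at (@subset_refl _ _))).
apply: (le_trans (lee_sum _ (fun jbe _ => level_bad_at_le jbe))).
rewrite sumEFin lee_fin.
rewrite -(pair_bigA _ (fun (jb : 'I_J.+2 * bool) (e : 'I_3) =>
   2 * expR (- (7 * La * (1 + jb.1%:R / 12)))))/=.
under eq_bigr do rewrite sumr_const card_ord.
rewrite -(pair_bigA _ (fun (j : 'I_J.+2) (b : bool) =>
   (2 * expR (- (7 * La * (1 + j%:R / 12)))) *+ 3))/=.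
under eq_bigr do rewrite sumr_const card_bool.
have h := @geometric_tail_le 7 1 3 (12 / 19) J.+2.
have : \sum_(j < J.+2) 1 ^+ j * expR (- (7 * La * (1 + j%:R / 12))) <= 3 * expR (- (7 * La)).
  apply: h; try lra.
  by apply: expRN_le; lra.
move=> {}h; apply: (@le_trans _ _ (12 * (3 * expR (- (7 * La))))); last lra.
apply: le_trans (ler_wpM2l _ h); last lra.
rewrite mulr_sumr; apply: ler_sum => j _; rewrite expr1n mul1r.
by rewrite -!mulrnA; move: (expR _) => y; rewrite -mulr_natr; lra.
Qed.

(* [4 * 2 ^ j] grid points on either side suffice, since
   [reach j / mesh j = (16 / 5) * 2 ^ (j / 4)]. *)
Definition grid_index (j : nat) (i : nat) : int := i%:Z - (4 * 2 ^ j)%N%:Z.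

Definition grid_dev (j : nat) (b : bool) (z : int) : set T :=
  [set w | m%:R * level j * mesh j <=
    `|hits P Z (side mu b (q (level j * (1 + z%:~R * mesh j)))) w
       - hits P Z (side mu b (node j)) w - m%:R * level j * (z%:~R * mesh j)|].

Definition grid_bad_at (j : nat) (bi : bool * 'I_(9 * 2 ^ j)) : set T :=
  let z := grid_index j bi.2 in
  if `|z%:~R * @mesh R j| <= reach j then grid_dev j bi.1 z else set0.

Lemma measurable_grid_bad_at j bi : measurable (grid_bad_at j bi).
Proof.
rewrite /grid_bad_at; case: ifP => // _.
apply: measurable_superlevel; apply: measurableT_comp => //.
apply: measurable_funB => //; apply: measurable_funB;
  by apply: measurable_hits; exact: measurable_side.
Qed.

Lemma grid_bad_at_le j bi : (j <= J)%N ->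
  (P (grid_bad_at j bi) <= (2 * expR (- (13 * La * (1 + j%:R / 12))))%:E)%E.
Proof.
move=> jJ; rewrite /grid_bad_at; case: ifPn => [zW|_]; last first.
  by rewrite measure0 lee_fin mulr_ge0// expR_ge0.
have l0 := level_gt0 m k k720 j; have l4 := level_le4 m k J k720 levelJ j jJ.
have u3 := @ratioX_gt0 R (3 * j); have u31 := @ratioX_le1 R (3 * j).
have u5 := @ratioX_gt0 R (5 * j).
have u53 : u ^+ (5 * j) <= u ^+ (3 * j) by apply: ratioX_anti; rewrite leq_mul2r orbT.
have W0 : 0 < @reach R j by apply: mulr_gt0; [lra|exact: u3].
have W1 : @reach R j <= 4 / 5 by rewrite /reach; move: (u ^+ _) u31 => a ?; lra.
have mW : @mesh R j <= reach j by rewrite /mesh /reach; move: (u ^+ _) (u ^+ _) u3 u53 => a c ? ?; lra.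
have e0 : 0 < @mesh R j by rewrite /mesh divr_gt0.
have ml0 : 0 < m%:R * level j by rewrite mulr_gt0.
set e := _ * mesh j in zW *.
have := zW; rewrite ler_norml => /andP[z1 z2].
have le1 : level j * (1 + e) <= 9 / 5 * level j by rewrite mulrC ler_pM2r//; lra.
have le0 : 1 / 5 * level j <= level j * (1 + e) by rewrite [leRHS]mulrC ler_pM2r//; lra.
have h := @grid_deviation _ _ _ P f hf mu m Z indZ densZ m0 bi.1 (level j) e
  (level j * reach j) (m%:R * level j * mesh j).
apply: (le_trans (h _ _ _ _ _ _ _ _)) => //.
- by lra.
- by lra.
- by lra.
- by rewrite ler_pM2l.
- by rewrite mulr_gt0.
- by rewrite mulr_ge0 ?ltW.
- have := ler_wpM2l (ltW ml0) mW; have := mulr_gt0 ml0 W0; lra.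
rewrite lee_fin ler_pM2l// ler_expR lerN2.
(* The increments have probability at most s_j [reach j], which improves the exponent to u^(7j);
   then 5/256 * 99/100 * 720 exceeds 13. *)
have -> : (m%:R * level j * mesh j) ^+ 2 / (4 * m%:R * (level j * reach j)) =
    5 / 256 * (m%:R * level j * u ^+ (7 * j)).
  have -> : u ^+ (7 * j) = u ^+ (5 * j) ^+ 2 / u ^+ (3 * j).
    rewrite -exprM (_ : 5 * j * 2 = 7 * j + 3 * j)%N; last by rewrite -mulnDl mulnAC.
    by rewrite exprD mulfK// gt_eqF.
  rewrite /mesh /reach; move: (u ^+ (5 * j)) (u ^+ (3 * j)) u3 => a c c0.
  by field; rewrite !gt_eqF.
have s1 := size_level_ge j; have s2 := linear_le_ratio 7 j isT.
have u7 := @ratioX_gt0 R (7 * j).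
have s3 := ler_wpM2r (ltW u7) s1.
have s4 : 0 < 1 + j%:R / 12 :> R by rewrite ltr_wpDr// divr_ge0.
have s5 : 720 * La * (1 + j%:R / 12) <= k%:R * (2 ^+ j * u ^+ (7 * j)).
  by apply: ler_pM kLa s2; [have := La0; lra|exact: ltW].
have s6 := mulr_gt0 La0 s4.
have s7 : 99 / 100 * (k%:R * (2 ^+ j * u ^+ (7 * j))) <= m%:R * level j * u ^+ (7 * j).
  by rewrite (_ : 99 / 100 * _ = 99 / 100 * (2 ^+ j * k%:R) * u ^+ (7 * j))//; ring.
rewrite -[13 * La * _]mulrA; rewrite -[720 * La * _]mulrA in s5.
move: s5 s6 s7; move: (La * _) (k%:R * _) (m%:R * level j * _) => ? ? ? ? ? ?; lra.
Qed.

Definition grid_bad : set T := \bigcup_(j : 'I_J.+1) \bigcup_bi grid_bad_at j bi.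

Lemma measurable_grid_bad : measurable grid_bad.
Proof.
apply: fin_bigcup_measurable; first exact: finite_finset.
move=> j _; apply: fin_bigcup_measurable; first exact: finite_finset.
by move=> bi _; exact: measurable_grid_bad_at.
Qed.

(** The number of grid points doubles with j, but 2 e^(-13/12) <= 24/25 < 1, so the levels sum to at
    most 25; 900 = 36 * 25, with 36 = 2 * 2 * 9. *)
Lemma grid_bad_le : (P grid_bad <= (900 * expR (- (13 * La)))%:E)%E.
Proof.
have mj (j : 'I_J.+1) : measurable (\bigcup_bi grid_bad_at j bi).
  apply: fin_bigcup_measurable; first exact: finite_finset.
  by move=> bi _; exact: measurable_grid_bad_at.
have Pj (j : 'I_J.+1) : (P (\bigcup_bi grid_bad_at j bi) <=
    (36 * (2 ^+ j * expR (- (13 * La * (1 + j%:R / 12)))))%:E)%E.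
  apply: (le_trans (@le_finite_union _ _ _ P _ (grid_bad_at j) _ (mj j)
    (measurable_grid_bad_at j) (@subset_refl _ _))).
  have jJ : (j <= J)%N by rewrite -ltnS.
  apply: (le_trans (lee_sum _ (fun bi _ => grid_bad_at_le j bi jJ))).
  rewrite sumEFin lee_fin sumr_const card_prod card_bool card_ord -[_ *+ (2 * _)]mulr_natr !natrM natrX.
  by rewrite le_eqVlt; apply/orP; left; apply/eqP; ring.
apply: (le_trans (@le_finite_union _ _ _ P _ _ _ measurable_grid_bad mj (@subset_refl _ _))).
apply: (le_trans (lee_sum _ (fun j _ => Pj j))).
rewrite sumEFin lee_fin -mulr_sumr.
have h := @geometric_tail_le 13 2 25 (12 / 25) J.+1.
have : \sum_(j < J.+1) 2 ^+ j * expR (- (13 * La * (1 + j%:R / 12))) <= 25 * expR (- (13 * La)).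
  apply: h; try lra.
  by apply: expRN_le; lra.
by move: (\sum_(_ < _) _) (expR _) => ? ? ?; lra.
Qed.

Lemma grid_badP j b z w : (j <= J)%N -> ~ grid_bad w -> `|z%:~R * @mesh R j| <= reach j ->
  ~ grid_dev j b z w.
Proof.
move=> jJ ng zW dev; apply: ng.
have zb : `|z%:~R| <= 4 * 2 ^+ j :> R.
  have e0 : 0 < mesh j :> R by rewrite /mesh divr_gt0// ratioX_gt0.
  rewrite -(ler_pM2r e0) -[X in _ * X](gtr0_norm e0) -normrM (le_trans zW)//.
  rewrite /reach /mesh.
  have h1 := @two_ratioX R j; have h2 := @ratioX_gt0 R (3 * j).
  have h3 : u ^+ (3 * j) <= 2 ^+ j * u ^+ (5 * j).
    have -> : u ^+ (3 * j) = 2 ^+ j * u ^+ (11 * j).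
      rewrite (_ : 11 * j = 8 * j + 3 * j)%N; last by rewrite -mulnDl.
      by rewrite exprD mulrA h1 mul1r.
    apply: ler_wpM2l; first exact: exprn_ge0.
    by apply: ratioX_anti; rewrite leq_mul2r orbT.
  by move: (u ^+ (3 * j)) (2 ^+ j * u ^+ (5 * j)) (2 ^+ j) h2 h3 => *; lra.
have zr : `|z| <= (4 * 2 ^ j)%N%:Z.
  by rewrite -(ler_int R) intr_norm (le_trans zb)// -pmulrn natrM natrX.
have Gn : (4 * 2 ^ j + 4 * 2 ^ j < 9 * 2 ^ j)%N.
  by rewrite -mulnDl ltn_mul2r expn_gt0.
have [i iG iE] := grid_surj _ _ _ Gn zr.
exists (Ordinal (jJ : (j < J.+1)%N)) => //; exists (b, Ordinal iG) => //.
by rewrite /grid_bad_at /= /grid_index iE zW.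
Qed.

End UnionBound.

(** * Accuracy of the estimator *)

Lemma failure_budget {R : realType} (delta : R) : 0 < delta -> delta <= 1 / 3 ->
  36 * delta ^+ 7 + 36 * delta ^+ 7 + (900 * delta ^+ 13 + 2 * delta ^+ 7) <= delta.
Proof.
move=> delta0 delta3.
have d2 : delta ^+ 2 <= 1 / 9.
  have t0 : 0 <= 1 / 3 :> R by lra.
  have : delta ^+ 2 <= (1 / 3) ^+ 2 by rewrite lerXn2r ?nnegrE// ltW.
  by move=> /le_trans; apply; lra.
have step i : delta ^+ (i + 2) <= delta ^+ i / 9.
  rewrite exprD; have := ler_wpM2l (exprn_ge0 i (ltW delta0)) d2.
  by move: (delta ^+ i) (delta ^+ 2) => x y; lra.
have h1 := step 1%N; have h3 := step 3%N; have h5 := step 5%N.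
have h7 := step 7%N; have h9 := step 9%N; have h11 := step 11%N.
move: h1 h3 h5 h7 h9 h11; rewrite !addn2 expr1.
move: (delta ^+ 3) (delta ^+ 5) (delta ^+ 7) (delta ^+ 9) (delta ^+ 11) (delta ^+ 13).
by move=> a b c e g h *; lra.
Qed.

Lemma lt_quarter_absurd {R : realType} (x : R) : 0 < x -> x < 4^-1 * x -> False.
Proof. by lra. Qed.

(** * Sample size, rank and top level *)

Section SampleSize.
Context {R : realType}.
Variables (delta : R) (n : nat).
Hypothesis delta0 : 0 < delta.
Hypothesis delta3 : delta <= 1 / 3.
Local Notation La := (ln (1 / delta)).
Local Notation m := (half_size n).
Local Notation k := (tail_rank delta).
Local Notation J := (max_level delta n).

Lemma log_inv_ge1 : 1 <= La.
Proof.
have d1 : 3 <= 1 / delta by rewrite ler_pdivlMr//; move: delta3; lra.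
rewrite -ler_expR lnK ?posrE ?divr_gt0// (le_trans _ d1)//.
have := @expR_le1Dx_sqr R 1; rewrite normr1 expr1n => /(_ (lexx _)) h.
by apply: (le_trans h); lra.
Qed.

Lemma expR_log_inv : expR (- La) = delta.
Proof. by rewrite expRN lnK ?posrE ?divr_gt0// div1r invrK. Qed.

Lemma tail_rank_bounds : 720 * La <= k%:R /\ k%:R <= 721 * La.
Proof.
have L1 := log_inv_ge1; rewrite /tail_rank; set x := 720 * La.
have x0 : 0 <= x by rewrite /x; lra.
have c0 : 0 <= Num.ceil x by rewrite -(ler_int R) (le_trans x0)// ceil_ge.
have -> : (`|Num.ceil x|%N)%:R = (Num.ceil x)%:~R :> R by rewrite -{2}(gez0_abs c0).
have /andP[h1 h2] := ceil_itv x; split => //.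
by move: h1; rewrite rmorphB/= /x; lra.
Qed.

Hypothesis n_ge : 100 * 100 * La <= n%:R.

Lemma half_size_bounds : n%:R <= 2 * m.+1%:R :> R /\ 4000 * La <= m%:R.
Proof.
have L1 := log_inv_ge1.
have e : (n <= 2 * m + 1)%N.
  by rewrite -{1}(odd_double_half n) /half_size -mul2n addnC leq_add2l; case: odd.
have e' : n%:R <= 2 * m%:R + 1 :> R.
  by rewrite -[2]/(2%:R) -natrM natr1 ler_nat -addn1.
split; first by rewrite -[m.+1%:R]natr1; lra.
by move: n_ge; lra.
Qed.

Lemma max_levelP : level m k J <= 4^-1 :> R /\ 4^-1 < level m k J.+1 :> R.
Proof.
have L1 := log_inv_ge1; have [k1 k2] := tail_rank_bounds; have [_ m1] := half_size_bounds.
have k1' : 1 <= k%:R :> R by lra.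
have k0 : 0 < k%:R :> R by lra.
have mp : 0 < m.+1%:R :> R by rewrite ltr0n.
have ok0 : 2 ^+ 0 * tail_level delta n <= 4^-1.
  rewrite expr0 mul1r /tail_level ler_pdivrMr// -[m.+1%:R]natr1.
  by move: k2 m1; lra.
have card : (0 < #|[pred j : 'I_m.+1 | (2 ^+ j * tail_level delta n <= 4^-1)%R]|)%N.
  by apply/card_gt0P; exists ord0.
have [j jP jE] := eq_bigmax_cond (fun j : 'I_m.+1 => j : nat) card.
have JE : J = j by rewrite -jE; apply: eq_bigl.
split; first by rewrite JE; exact: jP.
rewrite ltNge; apply/negP => h.
(* Inside the range, maximality of J is contradicted; outside it, 2^(J+1) > m + 1 already puts the
   level above 1/4. *)
have [jm|jm] := ltnP J.+1 m.+1.
  have := @leq_bigmax_cond _ [pred j : 'I_m.+1 | (2 ^+ j * tail_level delta n <= 4^-1)%R]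
    (fun j : 'I_m.+1 => j : nat) (Ordinal jm) h.
  by rewrite -[leqRHS]/(max_level delta n) /= ltnn.
have h1 : m.+1%:R < 2 ^+ J.+1 :> R.
  rewrite -natrX ltr_nat (leq_ltn_trans (_ : _ <= J.+1)%N)// ltn_expl//.
move: h; rewrite /level mulrA ler_pdivrMr// => h.
have := ler_wpM2l (ltW (lt_trans mp h1)) k1'; rewrite mulr1 => h2.
exact: (lt_quarter_absurd _ mp (lt_le_trans h1 (le_trans h2 h))).
Qed.

End SampleSize.

(** * Lower bound for the Hellinger modulus *)

Section Modulus.
Context {R : realType}.
Variables (f : R -> R) (hf : SUMHR f) (m k J : nat).
Hypothesis k720 : 720 <= k%:R :> R.
Hypothesis levelJ : level m k J <= 4^-1 :> R.
Hypothesis levelJ1 : 4^-1 < level m k J.+1 :> R.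

(** The radius K / info is admissible: [gap >= scale / 2] bounds the sum in [hellinger_shift] by 4
    info^2, and 32 * 4 = 128. *)
Lemma info_modulus (K t : R) : 0 <= K -> (4 + 128 * K ^+ 2) * (k%:R / m.+1%:R) <= t ->
  ((K / info J (scale f m k))%:E <= hellinger_modulus f t)%E.
Proof.
move=> K0 Kt; set A := info J _.
have A0 : 0 < A by apply: info_gt0 => j jJ; apply: (scale_gt0 f hf m k J) => //; exact: leqW.
have r0 : 0 <= K / A by rewrite divr_ge0// ltW.
apply: ereal_sup_ubound; exists (K / A) => //; split => //.
have p0 : 0 < k%:R / m.+1%:R :> R.
  by rewrite divr_gt0 ?ltr0n// -(@ltr_nat R); apply: lt_le_trans k720; lra.
have h := @hellinger_shift R f hf J (node f m k) (k%:R / m.+1%:R) (K / A) p0 r0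
  (node_ge0 f hf m k J k720 levelJ) (tail_node f hf m k J k720 levelJ) (ltW levelJ1).
apply: (le_trans h); rewrite lee_fin (le_trans _ Kt)//.
set p := k%:R / m.+1%:R in p0 *.
have S4 : \sum_(j < J.+1) 2 ^+ j / (node f m k j - node f m k j.+1) ^+ 2 <= 4 * A ^+ 2.
  rewrite info_sqr mulr_sumr; apply: ler_sum => j _; rewrite amp_sqr.
  have jJ : (j <= J)%N by rewrite -ltnS.
  have g0 := scale_gt0 f hf m k J k720 levelJ j (leqW jJ).
  have := gap_ge f hf m k J k720 levelJ j jJ; rewrite /gap.
  move: (scale f m k j) (_ - _) g0 => g L g0 gL.
  rewrite mulrCA ler_pM2l ?exprn_gt0// -[4]invrK -invfM lef_pV2 ?posrE ?exprn_gt0//; last 2 first.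
  - by lra.
  - by rewrite mulr_gt0 ?invr_gt0// exprn_gt0.
  have : (g / 2) ^+ 2 <= L ^+ 2 by rewrite lerXn2r// ?nnegrE; lra.
  by lra.
have c0 : 0 <= 32 * p * (K / A) ^+ 2.
  by apply: mulr_ge0; [lra|exact: sqr_ge0].
apply: (le_trans (lerD (lexx _) (ler_wpM2l c0 S4))).
rewrite le_eqVlt; apply/orP; left; apply/eqP; field; by rewrite gt_eqF.
Qed.

End Modulus.

(** * The estimator on the good event *)

Section Estimator.
Context {d : measure_display} {T : measurableType d} {R : realType}.
Variable P : probability T R.
Variables (delta : R) (n : nat) (f : R -> R) (hf : SUMHR f) (mu : R).
Variable X : 'I_n -> {RV P >-> R}.
Hypothesis iidX : iid_sample X (translate f mu).
Hypothesis delta0 : 0 < delta.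
Hypothesis delta3 : delta <= 1 / 3.
Local Notation La := (ln (1 / delta)).
Local Notation m := (half_size n).
Local Notation k := (tail_rank delta).
Local Notation J := (max_level delta n).
Hypothesis n_ge : 100 * 100 * La <= n%:R.

Let half_le : (m + m <= n)%N.
Proof. by have := leq_addl (odd n) n./2.*2; rewrite odd_double_half -addnn. Qed.

Let main_index (i : 'I_m) : 'I_n := widen_ord (leq_trans (leq_addr m m) half_le) i.
Let hold_index (i : 'I_m) : 'I_n := widen_ord half_le (rshift m i).

Let ZM (i : 'I_m) : {RV P >-> R} := X (main_index i).
Let ZH (i : 'I_m) : {RV P >-> R} := X (hold_index i).
Let sM w := [seq ZM i w | i <- enum 'I_m].
Let sH w := [seq ZH i w | i <- enum 'I_m].
Let sample w := [tuple X i w | i < n].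

Let main_sampleE w : main_sample (sample w) = sM w.
Proof.
rewrite /main_sample -[X in take _ X]drop0.
apply: (@take_drop_tuple R n 0 m (fun i => X i w) main_index) => //.
exact: leq_trans (leq_addr m m) half_le.
Qed.

Let holdout_sampleE w : holdout_sample (sample w) = sH w.
Proof. exact: (@take_drop_tuple R n m m (fun i => X i w) hold_index half_le). Qed.

Let indM : mutually_independent ZM.
Proof.
apply: independent_subfamily; last by case: iidX.
by move=> i j /(congr1 val)/= /val_inj.
Qed.

Let indH : mutually_independent ZH.
Proof.
apply: independent_subfamily; last by case: iidX.
by move=> i j /(congr1 val)/= /addnI/val_inj.
Qed.

Let densM i : has_density (ZM i) (translate f mu).
Proof. by case: iidX => _ h; exact: h. Qed.

Let densH i : has_density (ZH i) (translate f mu).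
Proof. by case: iidX => _ h; exact: h. Qed.

Let La1 : 1 <= La. Proof. exact: log_inv_ge1. Qed.
Let kLa : 720 * La <= k%:R. Proof. by have [] := tail_rank_bounds delta delta0 delta3. Qed.
Let k720 : 720 <= k%:R :> R. Proof. by move: La1 kLa; lra. Qed.
Let m99 : 99 <= m%:R :> R.
Proof. by have [_] := half_size_bounds delta n delta0 delta3 n_ge; move: La1; lra. Qed.
Let m0 : (0 < m)%N. Proof. by rewrite -(@ltr_nat R); apply: lt_le_trans m99; lra. Qed.
Let levelJ : level m k J <= 4^-1 :> R.
Proof. by have [] := max_levelP delta n delta0 delta3 n_ge. Qed.
Let levelJ1 : 4^-1 < level m k J.+1 :> R.
Proof. by have [] := max_levelP delta n delta0 delta3 n_ge. Qed.

Let rank_bounds j : (j <= J.+1)%N -> (0 < 2 ^ j * k <= m)%N.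
Proof.
move=> jJ; have l2 := level_le2 m k J k720 levelJ j jJ.
have k0 : (0 < k)%N by rewrite -(@ltr_nat R); apply: lt_le_trans k720; lra.
rewrite muln_gt0 expn_gt0 k0/= -ltnS -(@ltr_nat R) (rank_level m) natr1.
have : 0 < m.+1%:R :> R by rewrite ltr0n.
by move=> h; have := ler_wpM2l (ltW h) l2; lra.
Qed.

(** Outward distance from [mu] of the order statistic of rank 2^j k from the end [b]; in this form
    both tails obey the same inequalities. *)
Let os (s : T -> seq R) (b : bool) j w : R :=
  if b then order_stat (s w) (m.+1 - 2 ^ j * k) - mu
  else mu - order_stat (s w) (2 ^ j * k).

Let os_rightE (Z : 'I_m -> {RV P >-> R}) j x w : (j <= J.+1)%N ->
  (mu + x < order_stat [seq Z i w | i <- enum 'I_m] (m.+1 - 2 ^ j * k)) =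
  ((2 ^ j * k)%:R <= hits P Z (side mu true x) w).
Proof. by move=> jJ; exact: (order_stat_gt_hits m (fun i => Z i w) _ _ (rank_bounds _ jJ)). Qed.

Let os_leftE (Z : 'I_m -> {RV P >-> R}) j x w : (j <= J.+1)%N ->
  (order_stat [seq Z i w | i <- enum 'I_m] (2 ^ j * k) <= mu - x) =
  ((2 ^ j * k)%:R <= hits P Z (side mu false x) w).
Proof. by move=> jJ; exact: (order_stat_le_hits m (fun i => Z i w) _ _ (rank_bounds _ jJ)). Qed.

Let os_ge (Z : 'I_m -> {RV P >-> R}) w b j x : (j <= J.+1)%N ->
  (2 ^ j * k)%:R <= hits P Z (side mu b x) w ->
  x <= os (fun w => [seq Z i w | i <- enum 'I_m]) b j w.
Proof. by move=> jJ; case: b; rewrite /os -?os_rightE -?os_leftE//; lra. Qed.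

Let os_le (Z : 'I_m -> {RV P >-> R}) w b j x : (j <= J.+1)%N ->
  hits P Z (side mu b x) w < (2 ^ j * k)%:R ->
  os (fun w => [seq Z i w | i <- enum 'I_m]) b j w <= x.
Proof.
move=> jJ; rewrite ltNge; case: b; rewrite /os -?os_rightE -?os_leftE// => /negP h.
  by rewrite lerBlDl leNgt; apply/negP.
by rewrite lerBlDl -lerBlDr leNgt; apply/negP => h'; apply: h; exact: ltW.
Qed.

Let lhat w j : R := 2^-1 * ((os sH true j w - os sH true j.+1 w)
  + (os sH false j w - os sH false j.+1 w)).
Let center w j : R := 2^-1 * (os sM true j w - os sM false j w).

Let tail_spacingE w j : tail_spacing delta (sample w) j = lhat w j.
Proof.
by rewrite /tail_spacing holdout_sampleE /lhat /os/=; ring.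
Qed.

Let midsummaryE w j : midsummary (sample w) (2 ^ j * k) = center w j + mu.
Proof. by rewrite /midsummary main_sampleE /center /os/=; field. Qed.

Let weightE w j : weight delta (sample w) j = 2 ^+ j / lhat w j ^+ 2.
Proof. by rewrite /weight tail_spacingE. Qed.

Let mu_hatE w : mu_hat delta (sample w) =
  \sum_(j < J.+1) 2 ^+ j / lhat w j ^+ 2 / (\sum_(t < J.+1) 2 ^+ t / lhat w t ^+ 2)
    * (center w j + mu).
Proof.
rewrite /mu_hat; apply: eq_bigr => j _; rewrite midsummaryE /norm_weight weightE.
by congr (_ / _ * _); apply: eq_bigr => t _; rewrite weightE.
Qed.

Let measurable_os (Z : 'I_m -> {RV P >-> R}) b j : (j <= J.+1)%N ->
  measurable_fun setT (os (fun w => [seq Z i w | i <- enum 'I_m]) b j).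
Proof.
move=> jJ; have /andP[r0 rm] := rank_bounds _ jJ.
case: b; rewrite /os; apply: measurable_funB => //; apply: measurable_order_stat.
  by rewrite subn_gt0 ltnS rm leq_subLR -addn1 addnC leq_add2r r0.
by rewrite r0.
Qed.

Let measurable_lhat j : (j <= J)%N -> measurable_fun setT (lhat ^~ j).
Proof.
move=> jJ; apply: measurable_funM => //; apply: measurable_funD;
  by apply: measurable_funB; apply: measurable_os => //; exact: leqW.
Qed.

Let measurable_weight j : (j <= J)%N -> measurable_fun setT (fun w => 2 ^+ j / lhat w j ^+ 2).
Proof.
move=> jJ; apply: measurable_funM => //; apply: measurable_inv_ge0.
  by move=> w; exact: sqr_ge0.
by apply: measurable_funX; exact: measurable_lhat.
Qed.

Let weight_ge0 w j : 0 <= 2 ^+ j / lhat w j ^+ 2.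
Proof. by apply: divr_ge0; [exact: exprn_ge0|exact: sqr_ge0]. Qed.

Lemma measurable_mu_hat : measurable_fun setT (fun w => mu_hat delta (sample w)).
Proof.
under eq_fun do rewrite mu_hatE.
apply: measurable_sum => j; have jJ : (j <= J)%N by rewrite -ltnS.
apply: measurable_funM.
  apply: measurable_funM; first exact: measurable_weight.
  apply: measurable_inv_ge0; first by move=> w; apply: sumr_ge0.
  by apply: measurable_sum => t; apply: measurable_weight; rewrite -ltnS.
apply: measurable_funD => //; apply: measurable_funM => //.
by apply: measurable_funB; apply: measurable_os; exact: leqW.
Qed.

Let bad_main : set T := [set w | (28 * info J (scale f m k) <=
  `|\sum_(j < J.+1) 2 ^+ j / gap f m k j ^+ 2 * (scale f m k j / 2) /
      (m%:R * level m k j) * (hits P ZM (side mu true (node f m k j)) w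
        - hits P ZM (side mu false (node f m k j)) w)|)%R].

(** Levels are controlled in both halves; the grid and the main term concern the main half, whose
    mid-summaries are linearised. *)
Let bad : set T := (level_bad P f mu m ZM k J `|` level_bad P f mu m ZH k J) `|`
  (grid_bad P f mu m ZM k J `|` bad_main).

Let measurable_bad_main : measurable bad_main.
Proof.
apply: measurable_superlevel; apply: measurableT_comp => //.
apply: measurable_sum => j; apply: measurable_funM => //.
by apply: measurable_funB; apply: measurable_hits; exact: measurable_side.
Qed.

Let measurable_bad : measurable bad.
Proof.
apply: measurableU; apply: measurableU => //; [|exact: measurable_level_bad|].
  exact: measurable_level_bad.
exact: measurable_grid_bad.
Qed.

Let bad_main_le : (P bad_main <= (2 * expR (- (7 * La)))%:E)%E.
Proof.
have k0 : 0 < k%:R :> R by apply: lt_le_trans k720; lra.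
have p0 : 0 < k%:R / m.+1%:R :> R by apply: divr_gt0; [exact: k0|rewrite ltr0n].
have h := @main_deviation _ _ _ P f hf mu m ZM indM densM m0 J (k%:R / m.+1%:R)
  (node f m k) (scale f m k) (gap f m k) p0.
apply: (le_trans (h _ _ _ _ _)).
- by move=> j jJ; apply: (node_ge0 f hf m k J) => //; exact: leqW.
- by move=> j jJ; apply: (tail_node f hf m k J) => //; exact: leqW.
- exact: (node_anti f hf m k J).
- by move=> j jJ; apply: (scale_gt0 f hf m k J) => //; exact: leqW.
- exact: (gap_ge f hf m k J).
have h1 : 99 / 100 * k%:R <= m%:R * (k%:R / m.+1%:R) :> R.
  by have := @size_level_ge R m k m99 0; rewrite /level expr0 !mul1r.
rewrite lee_fin ler_pM2l// ler_expR lerN2.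
by move: h1 kLa La1; move: (m%:R * _) => y *; lra.
Qed.

Let bad_le : (P bad <= delta%:E)%E.
Proof.
have h1 := level_bad_le P f hf mu m ZM indM densM k J La m99 La1 kLa levelJ.
have h2 := level_bad_le P f hf mu m ZH indH densH k J La m99 La1 kLa levelJ.
have h3 := grid_bad_le P f hf mu m ZM indM densM k J La m99 La1 kLa levelJ.
have mL Z : measurable (level_bad P f mu m Z k J) by exact: measurable_level_bad.
have mG : measurable (grid_bad P f mu m ZM k J) by exact: measurable_grid_bad.
have U0 : (P bad <= P (level_bad P f mu m ZM k J `|` level_bad P f mu m ZH k J)
    + P (grid_bad P f mu m ZM k J `|` bad_main))%E.
  by apply: measureU2; apply: measurableU.
have U1 : (P (level_bad P f mu m ZM k J `|` level_bad P f mu m ZH k J) <=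
    P (level_bad P f mu m ZM k J) + P (level_bad P f mu m ZH k J))%E by apply: measureU2.
have U2 : (P (grid_bad P f mu m ZM k J `|` bad_main) <=
    P (grid_bad P f mu m ZM k J) + P bad_main)%E by apply: measureU2.
apply: (le_trans U0); apply: (le_trans (leeD U1 U2)).
apply: (le_trans (leeD (leeD h1 h2) (leeD h3 bad_main_le))).
rewrite -!EFinD lee_fin.
have e7 : expR (- (7 * La)) = delta ^+ 7 by rewrite -mulrN expRM_natl expR_log_inv.
have e13 : expR (- (13 * La)) = delta ^+ 13 by rewrite -mulrN expRM_natl expR_log_inv.
rewrite e7 e13; exact: failure_budget.
Qed.

Let good_dist w : ~ bad w ->
  `|mu_hat delta (sample w) - mu| <= 212 * 1000 / info J (scale f m k).
Proof.
move=> ngood.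
have lev Z : ~ level_bad P f mu m Z k J w -> forall b j (e : 'I_3), (j <= J.+1)%N ->
    `|hits P Z (side mu b (quantile f (level_point m k j e))) w - m%:R * level_point m k j e|
    < level_tol m k j.
  move=> nb b j e jJ; rewrite ltNge; apply/negP => h; apply: nb.
  by exists (Ordinal (jJ : (j < J.+2)%N), b, e).
have levM := lev ZM (fun h => ngood (or_introl (or_introl h))).
have levH := lev ZH (fun h => ngood (or_introl (or_intror h))).
have grM : forall b j (z : int), (j <= J)%N -> `|z%:~R * mesh j| <= reach j :> R ->
  `|hits P ZM (side mu b (quantile f (level m k j * (1 + z%:~R * mesh j)))) w -
    hits P ZM (side mu b (node f m k j)) w - m%:R * level m k j * (z%:~R * mesh j)|
    < m%:R * level m k j * mesh j.
  move=> b j z jJ zW; rewrite ltNge; apply/negP => h.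
  have ng : ~ grid_bad P f mu m ZM k J w by move=> h'; apply: ngood; right; left.
  exact: (grid_badP P f mu m ZM k J j b z w jJ ng zW).
have mn : `|\sum_(j < J.+1) 2 ^+ j / gap f m k j ^+ 2 * (scale f m k j / 2) /
      (m%:R * level m k j) * (hits P ZM (side mu true (node f m k j)) w
        - hits P ZM (side mu false (node f m k j)) w)| < 28 * info J (scale f m k).
  by rewrite ltNge; apply/negP => h; apply: ngood; right; right.
have W0 := @weight_sum_gt0 R f hf m k J m0 k720 levelJ
  (fun b x => hits P ZH (side mu b x) w) (fun b j => os sH b j w)
  (os_ge ZH w) (os_le ZH w) levH.
have h := @core_bound R f hf m k J m0 k720 levelJ
  (fun b x => hits P ZM (side mu b x) w) (fun b x => hits P ZH (side mu b x) w)
  (fun b j => os sM b j w) (fun b j => os sH b j w)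
  (os_ge ZM w) (os_le ZM w) (os_ge ZH w) (os_le ZH w) levM levH grM mn.
rewrite mu_hatE.
(* The normalised weights add up to 1 because their total is positive, so [mu] factors out. *)
have -> : \sum_(j < J.+1) 2 ^+ j / lhat w j ^+ 2 / (\sum_(t < J.+1) 2 ^+ t / lhat w t ^+ 2)
    * (center w j + mu) - mu = \sum_(j < J.+1) 2 ^+ j / lhat w j ^+ 2 /
    (\sum_(t < J.+1) 2 ^+ t / lhat w t ^+ 2) * center w j.
  under eq_bigr do rewrite mulrDr.
  rewrite big_split/= -mulr_suml -mulr_suml divff ?mul1r ?addrK// gt_eqF//.
exact: h.
Qed.

Lemma mu_hat_deviation :
  ((1 - delta)%:E <= P [set w | (`| mu_hat delta (sample w) - mu |%:E <=
     hellinger_modulus f (2 * 721 * (4 + 128 * (212 * 1000) ^+ 2) * La / n%:R))%E])%E.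
Proof.
have K0 : 0 <= 212 * 1000 :> R by lra.
move: K0 good_dist; move: (212 * 1000) => K K0 gd.
set t := 2 * 721 * _ * _ / _; set M := hellinger_modulus f t.
have n0 : 0 < n%:R :> R by move: n_ge La1; lra.
(* Monotonicity of P requires this event to be measurable; the modulus is extended-valued, so its
   infinite values are treated apart. *)
have mE : measurable [set w | (`|mu_hat delta (sample w) - mu|%:E <= M)%E].
  have mY : measurable_fun setT (fun w => - `|mu_hat delta (sample w) - mu|).
    apply: measurable_funN; apply: measurableT_comp => //; apply: measurable_funB => //.
    exact: measurable_mu_hat.
  case: M => [r||].
  - under eq_set do rewrite lee_fin -lerN2; exact: measurable_superlevel.
  - by rewrite (_ : [set w | _] = setT)//; apply/seteqP; split => w //= _; exact: leey.
  - by rewrite (_ : [set w | _] = set0)//; apply/seteqP; split => w.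
apply: (@le_trans _ _ (P (~` bad))).
  by rewrite probability_setC// EFinB leeB.
apply: le_measure; rewrite ?inE//; first exact: measurableC.
move=> w /= /gd h.
apply: (@le_trans _ _ ((K / info J (scale f m k))%:E)); first by rewrite lee_fin.
apply: (info_modulus f hf m k J k720 levelJ levelJ1 K t K0).
have [_ k2] := tail_rank_bounds delta delta0 delta3.
have [n2 _] := half_size_bounds delta n delta0 delta3 n_ge.
have c0 : 0 <= 4 + 128 * K ^+ 2 by have := sqr_ge0 K; lra.
rewrite /t; move: (4 + _) c0 => c c0.
have m1 : 0 < m.+1%:R :> R by rewrite ltr0n.
rewrite [leRHS](_ : _ = c * (2 * (721 * La) / n%:R)); last by ring.
apply: ler_wpM2l => //.
rewrite ler_pdivrMr// mulrAC ler_pdivlMr//.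
apply: (@le_trans _ _ (k%:R * (2 * m.+1%:R))).
  by apply: ler_wpM2l n2; exact: ler0n.
have := ler_wpM2r (ltW m1) k2.
by move: (721 * La) => y; move: k%:R m.+1%:R => a b' *; lra.
Qed.

End Estimator.

Theorem corollary1 (R : realType) :
  exists C C' : R, 0 < C /\ 0 < C' /\
    forall (delta : R) (n : nat) (f : R -> R),
      0 < delta -> delta <= 1 / 3 ->
      C' * ln (1 / delta) <= n%:R ->
      SUMHR f ->
      forall (mu : R) (d : measure_display) (T : measurableType d)
             (P : probability T R) (X : 'I_n -> {RV P >-> R}),
        iid_sample X (translate f mu) ->
        ((1 - delta)%:E <=
          P [set w | (`| mu_hat delta [tuple X i w | i < n] - mu |%:E <=
                      hellinger_modulus f (C * ln (1 / delta) / n%:R))%E])%E.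
Proof.
(* k / (m + 1) <= 2 * 721 log(1/delta) / n, and [info_modulus] with K = 212 * 1000 contributes 4 +
   128 K^2. The second constant ensures m >= 4000 log(1/delta), hence m >= 4 k. *)
exists (2 * 721 * (4 + 128 * (212 * 1000) ^+ 2)), (100 * 100).
have K0 : 0 <= (212 * 1000) ^+ 2 :> R by exact: sqr_ge0.
split; first by move: (_ ^+ 2) K0 => K K0; lra.
split; first by lra.
move=> delta n f delta0 delta3 n_ge hf mu d T P X iidX.
exact: mu_hat_deviation.
Qed.
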